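(* Let $X_{\lambda,\epsilon}$ be a smooth planar slow-fast system satisfying Assumptions 1--4 (stated in the context), let $\sigma$ be a section parameterized by $s\in[0,s_0]$ as in the context, let $S:[0,s_0]\to[0,s_0]$ be the associated slow relation function, and let $\tilde I(s)=\tilde I_-(s)+\tilde I_+(s)$, $s\in\,]0,s_0]$, be the associated slow divergence integral. Then the following statements hold. 1. The function $\tilde I$ has no zeros in $]0,s_0]$ if and only if $S$ is uniquely ergodic (i.e. $S$ admits precisely one invariant probability measure: the Dirac delta measure $\delta_0$ at $0$). 2. The function $\tilde I$ has a zero at $s=s_1\in\,]0,s_0]$ if and only if the Dirac delta measure $\delta_{s_1}$ at the point $s_1$ is $S$-invariant. 3. The function $\tilde I$ has exactly $k$ zeros $s_1<\dots<s_k$ in $]0,s_0]$ (counted without multiplicity) if and only if the set $\mathcal P_S$ of all $S$-invariant probability measures on $[0,s_0]$ is the convex hull of the Dirac delta measures $\delta_0,\delta_{s_1},\dots,\delta_{s_k}$: $$\mathcal P_S=\Big\{\eta_0\delta_0+\sum_{i=1}^k\eta_i\delta_{s_i}:\ \eta_0,\eta_i\ge 0,\ \sum_{i=0}^k\eta_i=1\Big\}.$$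
   Context: Smooth means $C^\infty$. Probability measures are Borel probability measures on $[0,s_0]$; $\mu$ is $S$-invariant if $\mu(S^{-1}(A))=\mu(A)$ for all Borel sets $A$. **Slow-fast system.** Let $M\subset\mathbb R^2$ be open, $\lambda_0\in\mathbb R^r$, and let $X_{\lambda,\epsilon}=X_{\lambda,0}+\epsilon Q_\lambda+O(\epsilon^2)$ be a smooth family of vector fields on $M$, with $0\le\epsilon\ll1$ and $\lambda$ in a small neighborhood of $\lambda_0$. The fast subsystem $X_{\lambda,0}$ has a set $\mathcal S_\lambda$ (critical curve) of non-isolated singularities, and each $p\in\mathcal S_{\lambda_0}$ has an open neighborhood $U\subset M$ on which $X_{\lambda,0}=F_\lambda Z_\lambda$, where $F_\lambda$ is a smooth family of functions with $\nabla F_\lambda\neq0$ on $\{F_\lambda=0\}$ and $Z_\lambda$ is a smooth family of vector fields without singularities; so $\mathcal S_\lambda\cap U=\{F_\lambda=0\}$. The fast foliation $\mathcal F_\lambda$ is the smooth one-dimensional foliation on $M$ tangent to $Z_\lambda$ in each such local expression; $l_{\lambda,p}$ is its leaf through $p$. Away from $\mathcal S_\lambda$, orbits of $X_{\lambda,0}$ lie in leaves of $\mathcal F_\lambda$. A point $p\in\mathcal S_\lambda$ is normally hyperbolic if $DX_{\lambda,0}(p)$ has a nonzero eigenvalue $E_\lambda(p)$ (equal to the divergence of $X_{\lambda,0}$ at $p$); it is attracting if $E_\lambda(p)<0$, repelling if $E_\lambda(p)>0$. A point $p\in\mathcal S_\lambda$ is a contact point if both eigenvalues of $DX_{\lambda,0}(p)$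 are zero. A curve in $\mathcal S_\lambda$ is normally attracting (repelling) if all its points are normally hyperbolic and attracting (repelling). The contact order $n$ of a contact point $p_0$ (for $\lambda=\lambda_0$) is the intersection multiplicity at $p_0$ of $\mathcal S_{\lambda_0}$ and the leaf $l_{\lambda_0,p_0}$ (possibly $n=\infty$). Its singularity order $m$ is the order at $p_0$ of the function $p\in\mathcal S_{\lambda_0}\cap U\mapsto\Omega(Q_{\lambda_0},Z_{\lambda_0})(p)$, where $X_{\lambda,0}=F_\lambda Z_\lambda$ is a local expression on an open neighborhood $U\subset M$ of $p_0$, with $F_\lambda$ a smooth family of functions such that $\nabla F_\lambda\neq0$ on $\{F_\lambda=0\}$ and $Z_\lambda$ a smooth family of vector fields without singularities, and $\Omega$ is any area form on $U$ (independent of choices). At a normally hyperbolic $p\in\mathcal S_\lambda$, the slow vector field $\hat Q_\lambda(p)\in T_p\mathcal S_\lambda$ is the linear projection of $Q_\lambda(p)$ onto $T_p\mathcal S_\lambda$ in the direction parallel to $T_pl_{\lambda,p}$; its time variable (slow time) is $\tau$. For a normally hyperbolic segment $\gamma\subset\mathcal S_\lambda$ without singularities of $\hat Q_\lambda$, the slow divergence integral is $I(\gamma,\lambda)=\int_{\tau_1}^{\tau_2}E_\lambda(\tilde\gamma(\tau))\,d\tau$, where $\tilde\gamma:[\tau_1,\tau_2]\to\mathbb R^2$ parameterizes $\gamma$, $\tilde\gamma'(\tau)=\hat Q_\lambda(\tilde\gamma(\tau))$ and $\tilde\gamma(\tau_1),\tilde\gamma(\tau_2)$ are the end points of $\gamma$.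 **Assumptions.** - Assumption 1: $\mathcal S_{\lambda_0}=\gamma_-\cup\{p_0\}\cup\gamma_+$, where $\gamma_-$ is normally attracting, $\gamma_+$ is normally repelling and $p_0$ is a contact point between them. - Assumption 2: the singularity order $m$ of $p_0$ is finite and odd. - Assumption 3: $\hat Q_{\lambda_0}$ has no singularities on $\gamma_-\cup\gamma_+$ and points from $\gamma_-$ to $\gamma_+$. - Assumption 4: $m<2(n-1)$. Under these assumptions the following limits are finite: for a segment $[q,p_0]\subset\gamma_-\cup\{p_0\}$, $I_-([q,p_0])=\lim_{p\to p_0,\,p\in\gamma_-}I([q,p],\lambda_0)<0$; for a segment $[q,p_0]\subset\gamma_+\cup\{p_0\}$, $I_+([q,p_0])=\lim_{p\to p_0,\,p\in\gamma_+}I([q,p],\lambda_0)>0$. **Section and slow relation function.** $\sigma\subset M$ is a smooth closed section transverse to $\mathcal F_{\lambda_0}$ with end point $p_0$, parameterized by a regular parameter $s\in[0,s_0]$, $s_0>0$, with $s=0$ corresponding to $p_0$; $\sigma\setminus\{p_0\}$ lies in the basin of attraction of $\gamma_-$ and, in backward time, in the basin of attraction of $\gamma_+$ (for $X_{\lambda_0,0}$). For $s\in\,]0,s_0]$ let $\omega(s)\in\gamma_-$ and $\alpha(s)\in\gamma_+$ be the $\omega$- and $\alpha$-limit points of the orbit of $X_{\lambda_0,0}$ through $s\in\sigma$, and put $\tilde I_-(s)=I_-([\omega(s),p_0])$, $\tilde I_+(s)=I_+([\alpha(s),p_0])$, $\tilde I_\pm(0)=0$. The slow relation function $S:[0,s_0]\to[0,s_0]$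 is defined by $S(0)=0$ and, for $s\in\,]0,s_0]$: if $-\tilde I_-(s_0)\le\tilde I_+(s_0)$, by $\tilde I_-(s)+\tilde I_+(S(s))=0$; if $-\tilde I_-(s_0)>\tilde I_+(s_0)$, by $\tilde I_-(S(s))+\tilde I_+(s)=0$. ($S$ is well defined and continuous.) *)

(* Defs.v *)
From HB Require Import structures.
From mathcomp Require Import all_boot all_order all_algebra.
From mathcomp Require Import all_classical all_reals all_analysis.

Set Implicit Arguments.
Unset Strict Implicit.
Unset Printing Implicit Defensive.

Import Order.TTheory GRing.Theory Num.Theory.
Import numFieldNormedType.Exports.

Local Open Scope classical_set_scope.
Local Open Scope ring_scope.

Section Smoothness.
Context {R : realType} {V W : normedModType R}.

(* Class C^k on an open set [U].  In finite dimension this is the usual notion: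
   a differentiable map all of whose directional derivatives are of class
   C^(k-1). *)
Fixpoint class_C (k : nat) (U : set V) (f : V -> W) : Prop :=
  match k with
  | 0%N => forall x, U x -> {for x, continuous f}
  | k'.+1 => (forall x, U x -> differentiable f x) /\
             (forall v : V, class_C k' U ('D_v f))
  end.

(* On a set that is not open, smoothness means that [f] extends smoothly to an
   open neighbourhood.  The values of the total function [f] off [A] carry no
   information, so [f] itself is taken to be the extension. *)
Definition smooth_on (A : set V) (f : V -> W) : Prop :=
  exists U : set V, [/\ open U, A `<=` U & forall k, class_C k U f].

End Smoothness.

Section Planar.
Context {R : realType}.
Local Notation plane := 'rV[R]_2.
Implicit Types (M U C Sc : set plane) (X Q Z : plane -> plane) (p v : plane).

(* Set of non-isolated singularities in [M]. *)
Definition critical_set M X : set plane :=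
  [set p | [/\ M p, X p = 0 & limit_point [set q | M q /\ X q = 0] p]].

Definition local_expression M X U (F : plane -> R) Z : Prop :=
  [/\ [/\ open U, U `<=` M, smooth_on U F & smooth_on U Z],
      forall p, U p -> X p = F p *: Z p,
      forall p, U p -> Z p != 0 &
      forall p, U p -> F p = 0 -> exists v, 'D_v F p != 0].

(* A slow-fast family [X lam eps] for [lam] in a neighbourhood [Lam] of [lam0]
   and [0 <= eps < eps0], with first-order term [Q lam]. *)
Definition slow_fast_family (r : nat) M (Lam : set 'rV[R]_r) (lam0 : 'rV[R]_r)
    (eps0 : R) (X : 'rV[R]_r -> R -> plane -> plane)
    (Q : 'rV[R]_r -> plane -> plane) : Prop :=
  [/\ [/\ open M, open Lam, Lam lam0 & 0 < eps0],
      smooth_on (Lam `*` `[0, eps0[ `*` M)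
        (fun z : 'rV[R]_r * R * plane => X z.1.1 z.1.2 z.2),
      forall lam p, Lam lam -> M p ->
        (fun e : R => X lam e p - X lam 0 p - e *: Q lam p)
          =O_ (0^'+) (fun e : R => e ^+ 2) &
      forall p, critical_set M (X lam0 0) p ->
        exists (U : set plane) (L : set 'rV[R]_r)
               (F : 'rV[R]_r -> plane -> R) (Z : 'rV[R]_r -> plane -> plane),
          [/\ [/\ U p, open L, L lam0 & L `<=` Lam],
              smooth_on (L `*` U) (fun z : 'rV[R]_r * plane => F z.1 z.2),
              smooth_on (L `*` U) (fun z : 'rV[R]_r * plane => Z z.1 z.2) &
              forall lam, L lam ->
                local_expression M (X lam 0) U (F lam) (Z lam)]].

(* A chart of a one-dimensional foliation: a diffeomorphism from [fdom] onto
   the open square; its plaques are the level sets of the second coordinate. *)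
Record fol_chart := FolChart {
  fdom : set plane;
  fcoord : plane -> plane;
  finvc : plane -> plane }.

Definition square : set plane := [set z | forall i, -1 < z 0 i < 1].

Definition transverse_coord (c : fol_chart) (p : plane) : R := fcoord c p 0 1.

Definition is_fol_chart M (c : fol_chart) : Prop :=
  [/\ [/\ open (fdom c) & fdom c `<=` M],
      smooth_on (fdom c) (fcoord c), smooth_on square (finvc c),
      forall p, fdom c p -> square (fcoord c p) /\ finvc c (fcoord c p) = p &
      forall z, square z -> fdom c (finvc c z) /\ fcoord c (finvc c z) = z].

(* A smooth one-dimensional foliation of [M], given by a foliated atlas; the
   last clause says that changes of charts preserve the plaques. *)
Definition is_foliation M (A : set fol_chart) : Prop :=
  [/\ forall c, A c -> is_fol_chart M c,
      forall p, M p -> exists2 c, A c & fdom c p &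
      forall c c' p v, A c -> A c' -> fdom c p -> fdom c' p ->
        'D_v (transverse_coord c) p = 0 -> 'D_v (transverse_coord c') p = 0].

(* [v] is tangent at [p] to the leaf through [p]. *)
Definition leaf_tangent (A : set fol_chart) p v : Prop :=
  forall c, A c -> fdom c p -> 'D_v (transverse_coord c) p = 0.

Inductive leaf (A : set fol_chart) (p : plane) : plane -> Prop :=
| leaf_refl : leaf A p p
| leaf_plaque (q q' : plane) (c : fol_chart) :
    leaf A p q -> A c -> fdom c q -> fdom c q' ->
    transverse_coord c q = transverse_coord c q' -> leaf A p q'.

Definition fast_foliation M X (A : set fol_chart) : Prop :=
  [/\ is_foliation M A,
      forall U F Z p, local_expression M X U F Z -> U p ->
        leaf_tangent A p (Z p) &
      forall p, M p -> ~ critical_set M X p -> leaf_tangent A p (X p)].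

Definition eigval X p : R := \tr ('J X p).

Definition normally_hyperbolic X p : Prop :=
  exists2 e : R, e != 0 & eigenvalue ('J X p) e.

Definition attracting X p : Prop := normally_hyperbolic X p /\ eigval X p < 0.

Definition repelling X p : Prop := normally_hyperbolic X p /\ 0 < eigval X p.

(* Both eigenvalues, counted with multiplicity, vanish. *)
Definition contact_point X p : Prop := char_poly ('J X p) = 'X^2.

(* [c] is, near 0, a smooth curve inside the set [C] with [c 0 = p]. *)
Definition curve_germ C p (c : R -> plane) : Prop :=
  [/\ smooth_on [set 0 : R] c, c 0 = p & \forall t \near (0 : R), C (c t)].

Definition tangent_vector C p v : Prop :=
  exists2 c, curve_germ C p c & 'D_1 c 0 = v.

(* Order of vanishing at [0]; [None] stands for infinite order. *)
Definition vanishing_order (h : R -> R) (k : option nat) : Prop :=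
  match k with
  | Some k => (forall j, (j < k)%N -> derive1n j h 0 = 0) /\
              derive1n k h 0 != 0
  | None => forall j, derive1n j h 0 = 0
  end.

(* Intersection multiplicity at [p] of [{F = 0}] and the leaf through [p]. *)
Definition contact_order M X (A : set fol_chart) p (n : option nat) : Prop :=
  exists U F Z c,
    [/\ local_expression M X U F Z, U p, curve_germ (leaf A p) p c,
        'D_1 c 0 != 0 & vanishing_order (F \o c) n].

Definition area_form (w : plane -> R) p (u v : plane) : R :=
  w p * (u 0 0 * v 0 1 - u 0 1 * v 0 0).

(* Order at [p] of Omega(Q, Z) along the critical curve, for the area form
   Omega of density [w]. *)
Definition singularity_order M X Q p (m : option nat) : Prop :=
  exists U F Z w c,
    [/\ [/\ local_expression M X U F Z & U p],
        smooth_on U w /\ (forall q, U q -> w q != 0),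
        curve_germ (critical_set M X) p c,
        'D_1 c 0 != 0 &
        vanishing_order (fun t => area_form w (c t) (Q (c t)) (Z (c t))) m].

(* Projection of [Q p] onto the tangent line of the critical curve [Sc] in the
   direction of the leaf; meaningful where [p] is normally hyperbolic, since the
   two lines are then transverse. *)
Definition slow_field Sc (A : set fol_chart) Q p : plane :=
  xget 0 [set v | tangent_vector Sc p v /\ leaf_tangent A p (Q p - v)].

(* [gam], restricted to ]-1, 1[, is a smooth regular parametrization of the
   critical curve, with [gam 0 = p0]. *)
Definition critical_arc Sc p0 (gam : R -> plane) : Prop :=
  [/\ smooth_on (`]-1, 1[ : set R) gam,
      forall u, -1 < u < 1 -> 'D_1 gam u != 0,
      {in `]-1, 1[ &, injective gam},
      gam @` `]-1, 1[ = Sc & gam 0 = p0].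

Definition gamma_minus (gam : R -> plane) : set plane := gam @` `]-1, 0[.
Definition gamma_plus (gam : R -> plane) : set plane := gam @` `]0, 1[.

Definition assumption1 M X p0 (gam : R -> plane) : Prop :=
  [/\ critical_arc (critical_set M X) p0 gam,
      forall p, gamma_minus gam p -> attracting X p,
      forall p, gamma_plus gam p -> repelling X p &
      contact_point X p0].

(* No singularities, and pointing in the direction of increasing [u], that is
   from gamma_minus to gamma_plus. *)
Definition assumption3 (Qh : plane -> plane) (gam : R -> plane) : Prop :=
  forall u, -1 < u < 1 -> u != 0 ->
    exists2 a : R, 0 < a & Qh (gam u) = a *: 'D_1 gam u.

(* m < 2 (n - 1) *)
Definition assumption4 (n : option nat) (m : nat) : Prop :=
  if n is Some n' then (m < 2 * (n' - 1))%N else True.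

(* As the slow field points towards increasing parameters of [gam], slow time
   runs from the end point of smaller parameter to the other one: [I] is the
   slow divergence integral of the segment [gam @` `[u1, u2]], u1 < u2. *)
Definition slow_divergence_integral X (Qh : plane -> plane)
    (gam : R -> plane) (u1 u2 I : R) : Prop :=
  exists (t1 t2 : R) (g : R -> plane),
    [/\ t1 < t2 /\ {within `[t1, t2], continuous g},
        forall t, t1 < t < t2 -> is_derive t 1 g (Qh (g t)),
        g @` `[t1, t2] = gam @` `[u1, u2],
        g t1 = gam u1 /\ g t2 = gam u2 &
        I = \int[lebesgue_measure]_(t in `[t1, t2]) eigval X (g t)].

(* I_-([q, p0]) = l, resp. I_+([q, p0]) = l: the limit of the integrals
   I([q, p]) as p -> p0, where q and p have parameters [u] and [t]. *)
Definition I_minus X Qh (gam : R -> plane) (q : plane) (l : R) : Prop :=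
  exists u : R, [/\ -1 < u < 0, q = gam u &
    exists2 J : R -> R,
      forall t, u < t < 0 -> slow_divergence_integral X Qh gam u t (J t) &
      J t @[t --> 0^'-] --> l].

Definition I_plus X Qh (gam : R -> plane) (q : plane) (l : R) : Prop :=
  exists u : R, [/\ 0 < u < 1, q = gam u &
    exists2 J : R -> R,
      forall t, 0 < t < u -> slow_divergence_integral X Qh gam t u (J t) &
      J t @[t --> 0^'+] --> l].

Definition transverse_section M (A : set fol_chart) p0 (s0 : R)
    (sigma : R -> plane) : Prop :=
  [/\ smooth_on (`[0, s0] : set R) sigma /\ {in `[0, s0] &, injective sigma},
      sigma 0 = p0,
      forall s : R, 0 <= s <= s0 -> M (sigma s),
      forall s : R, 0 <= s <= s0 -> 'D_1 sigma s != 0 &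
      forall s : R, 0 <= s <= s0 -> ~ leaf_tangent A (sigma s) ('D_1 sigma s)].

(* The orbit of [X] through [p] has [a] and [w] as its alpha- and omega-limit
   point. *)
Definition orbit_limits M X p (a w : plane) : Prop :=
  exists x : R -> plane,
    [/\ x 0 = p, forall t, M (x t) /\ is_derive t 1 x (X (x t)),
        x t @[t --> -oo] --> a & x t @[t --> +oo] --> w].

(* [om] and [al] give the omega- and alpha-limit points of the points of the
   section; in particular the section minus [p0] lies in the two basins. *)
Definition section_limits M X (gam : R -> plane) (s0 : R)
    (sigma om al : R -> plane) : Prop :=
  forall s : R, 0 < s <= s0 ->
    [/\ gamma_minus gam (om s), gamma_plus gam (al s) &
        orbit_limits M X (sigma s) (al s) (om s)].

Definition section_integrals X Qh (gam : R -> plane) (s0 : R)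
    (om al : R -> plane) (Im Ip : R -> R) : Prop :=
  [/\ Im 0 = 0, Ip 0 = 0 &
      forall s : R, 0 < s <= s0 ->
        I_minus X Qh gam (om s) (Im s) /\ I_plus X Qh gam (al s) (Ip s)].

(* The two cases are exclusive; the relation is required together with the
   continuity of [S]. *)
Definition slow_relation_function (s0 : R) (Im Ip S : R -> R) : Prop :=
  [/\ forall s : R, 0 <= s <= s0 -> 0 <= S s <= s0,
      {within `[0, s0], continuous S},
      S 0 = 0,
      - Im s0 <= Ip s0 -> forall s : R, 0 < s <= s0 -> Im s + Ip (S s) = 0 &
      Ip s0 < - Im s0 -> forall s : R, 0 < s <= s0 -> Im (S s) + Ip s = 0].

End Planar.

Section InvariantMeasures.
Context {R : realType}.
Implicit Types (S : R -> R) (mu nu : probability R R).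

(* A Borel probability measure on [0, s0] is represented by the Borel
   probability measure on the line giving full mass to [0, s0]. *)
Definition invariant_measure (s0 : R) S mu : Prop :=
  mu `[0, s0]%classic = 1%E /\
  forall A : set R, measurable A -> A `<=` `[0, s0] ->
    mu (`[0, s0] `&` S @^-1` A) = mu A.

(* Measures of the library are functions on all sets, so equality of Borel
   measures is agreement on the measurable sets. *)
Definition same_measure mu nu : Prop :=
  forall A : set R, measurable A -> mu A = nu A.

Definition uniquely_ergodic (s0 : R) S : Prop :=
  invariant_measure s0 S \d_(0 : R) /\
  forall mu, invariant_measure s0 S mu -> same_measure mu \d_(0 : R).

Definition in_hull_of_diracs (k : nat) (z : 'I_k -> R) mu : Prop :=
  exists (eta0 : R) (eta : 'I_k -> R),
    [/\ 0 <= eta0, forall i, 0 <= eta i, eta0 + \sum_i eta i = 1 &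
        forall A : set R, measurable A ->
          mu A = (eta0%:E * \d_(0%R : R) A + \sum_i (eta i)%:E * \d_(z i) A)%E].

End InvariantMeasures.

(* Main.v *)
Require Import Defs.
From HB Require Import structures.
From mathcomp Require Import all_boot all_order all_algebra.
From mathcomp Require Import all_classical all_reals all_analysis.
From mathcomp Require Import lra ring.

Set Implicit Arguments.
Unset Strict Implicit.
Unset Printing Implicit Defensive.

Import Order.TTheory GRing.Theory Num.Theory.
Import numFieldNormedType.Exports.

Local Open Scope classical_set_scope.
Local Open Scope ring_scope.

(* The orbit of [X lam0 0] through a point of the section stays in a leaf, and
   near a normally attracting point of the critical curve the transverse
   coordinate of a foliated chart labels leaves injectively.  Following leaves
   along a compact piece of orbit, the parameter on the critical curve of the
   omega-limit point is a continuous, locally injective function of [s] on the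
   interval ]0, s0], hence injective; time reversal gives the same for the
   alpha-limit point.  As the divergence has constant sign on each branch, [Im]
   and [Ip] are injective and nonzero on ]0, s0].  So [S] is injective and
   continuous, thus increasing, and the zeros of [Im + Ip] are its nonzero fixed
   points.  Finally, an invariant probability measure of an increasing map gives
   the same mass to the nested sets {S <= q} and {id <= q} for every rational
   [q], so that it lives on the set of fixed points. *)

(** * Invariant measures of monotone interval maps *)

(** A leaf may a priori return to the same chart in another plaque, so the leaves met by the section
    cannot be labelled globally; transversality separates them only near a given [s]. This is why
    injectivity is proved locally and then globalized on the interval. No flow is constructed: the
    trajectories are those supplied by the limit points, and their dependence on the initial point
    is estimated directly. That estimate covers bounded times, whereas a limit point is reached in
    infinite time. The gap is closed by a stability estimate which traps all nearby orbits around
    the limit point from a common time on. A local expression [X = G *: Z] serves twice there: the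
    derivative of [G] along [Z] is the divergence, so its sign makes [G] decay along orbits; and
    since it is nonzero, a plaque near the limit point contains at most one critical point. *)

Section InvariantMeasuresOfMonotoneMaps.
Context {R : realType} (s0 : R) (S : R -> R).
Hypothesis S_itv : forall s : R, 0 <= s <= s0 -> 0 <= S s <= s0.
Hypothesis S_cont : {within `[0, s0], continuous S}.
Hypothesis S_homo : {in `[0, s0] &, {homo S : x y / x <= y}}.

Let I (q : R) : set R := `[0, s0] `&` `]-oo, q].
Let P (q : R) : set R := `[0, s0] `&` S @^-1` `]-oo, q].

Let measurable_I q : measurable (I q).
Proof. exact: measurableI. Qed.

Let measurable_S : measurable_fun `[0, s0] S.
Proof. exact: measurable_realfun.subspace_continuous_measurable_fun. Qed.

Let measurable_P q : measurable (P q).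
Proof. exact: measurable_S. Qed.

(** Invariance speaks only of Borel subsets of the interval, so the half-line is cut down to it;
    nothing is lost because [S] maps the interval into itself. *)
Let PE q : P q = `[0, s0] `&` S @^-1` (I q).
Proof.
apply/seteqP; split => x [] /= xs; rewrite ?in_itv /= => Sx.
  by split => //; split => //=; rewrite in_itv/= S_itv//; rewrite in_itv in xs.
by case: Sx => _ Sx; split.
Qed.

(** By monotonicity both sets are initial segments of the interval, hence comparable. Outside the
    interval [q] makes [P q] empty or [I q] everything. *)
Let nestedP q : P q `<=` I q \/ I q `<=` P q.
Proof.
have [q0|q0] := boolP (q \in `[0, s0]); last first.
  have [q1|q1] := ltP q 0.
    left=> x [] /= xs Sx; move: (xs); rewrite in_itv /= => /S_itv.
    by move: Sx; rewrite in_itv /= => Sx /andP[S1 _]; have := le_lt_trans S1 (le_lt_trans Sx q1); rewrite ltxx.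
  move: q0; rewrite in_itv /= q1 /= -ltNge => q2.
  left=> x [] /= xs _; split=> //=; move: xs; rewrite !in_itv /= => /andP[_ xs].
  exact: le_trans xs (ltW q2).
have [Sq|Sq] := leP (S q) q.
  right=> x [] /= xs; rewrite in_itv /= => xq; split => //=; rewrite in_itv /=.
  by apply: le_trans Sq; exact: S_homo.
left=> x [] /= xs; rewrite in_itv /= => Sx; split => //=; rewrite in_itv /=.
by rewrite leNgt; apply/negP => /ltW qx; have := lt_le_trans Sq (le_trans (S_homo q0 xs qx) Sx);
  rewrite ltxx.
Qed.

(* [{S <= q}] and [{id <= q}] are nested and have the same mass, so the points
   that [S] moves across a rational [q] form a null set. *)
Lemma invariant_measure_fixed (mu : probability R R) (A : set R) :
  invariant_measure s0 S mu -> measurable A ->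
  (forall s, A s -> 0 <= s <= s0 -> S s <> s) -> mu A = 0%E.
Proof.
move=> [mu1 muS] mA Afix.
have nullD (B C : set R) : measurable B -> measurable C ->
    mu B = mu C -> B `<=` C \/ C `<=` B -> mu (B `\` C) = 0%E.
  move=> mB mC muBC [BC|CB].
    by rewrite (_ : B `\` C = set0) ?measure0//; apply/seteqP; split => // x [] /BC.
  rewrite measureD//; last by rewrite (le_lt_trans (probability_le1 _ _))// ltry.
  rewrite setIC (setIidl CB); apply/eqP; rewrite sube_eq ?add0e ?muBC ?fin_num_measure//; exact/eqP.
pose N (q : R) : set R := (P q `\` I q) `|` (I q `\` P q).
have N0 q : mu.-negligible (N q).
  have muPI : mu (P q) = mu (I q) by rewrite PE muS// => x [].
  apply: negligibleU; apply/negligibleP; try exact: measurableD.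
    by apply: nullD => //; exact: nestedP.
  by apply: nullD => //; have [] := nestedP q; [right|left].
have n0 : mu.-negligible (~` `[0, s0]).
  apply/negligibleP; first exact: measurableC.
  by apply: (etrans (probability_setC mu (measurable_itv `[0, s0]))); rewrite mu1 subee.
(* The union over the rationals is indexed by [nat] through their codes; a number that codes no
   rational contributes the empty set. *)
pose G (k : nat) : set R := if unpickle k is Some q then N (ratr (q : rat)) else set0.
have G0 : mu.-negligible (\bigcup_k G k).
  apply: negligible_bigcup => k; rewrite /G; case: unpickle => // *; exact: negligible_set0.
have NG (q : rat) s : N (ratr q) s -> (\bigcup_k G k) s.
  by move=> Ns; exists (pickle q); [exact: Logic.I|rewrite /G pickleK; exact: Ns].
apply/negligibleP; first exact: mA.
apply: (negligibleS _ (negligibleU n0 G0)).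
move=> s As; have [s01|s01] := boolP (s \in `[0, s0]); last by left; apply/negP.
right.
have Sneq : S s != s by apply/eqP; apply: Afix.
have [Slt|Sge] := ltP (S s) s.
  have [q] := rat_in_itvoo Slt; rewrite in_itv /= => /andP[q1 q2].
  apply: (NG q); left; split.
    by split => //=; rewrite in_itv /= ltW.
  by move=> [_] /=; rewrite in_itv /= leNgt q2.
have sS : s < S s by rewrite lt_neqAle eq_sym Sneq.
have [q] := rat_in_itvoo sS; rewrite in_itv /= => /andP[q1 q2].
apply: (NG q); right; split.
  by split => //=; rewrite in_itv /= ltW.
by move=> [_] /=; rewrite in_itv /= leNgt q2.
Qed.

(** The weights are the masses of the points [0] and [z i]. Once these are removed, a Borel set
    contains no fixed point of the interval and is null; evaluating at [setT] shows that the weights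
    add up to one. *)
Lemma invariant_measure_in_hull (k : nat) (z : 'I_k -> R) (mu : probability R R) :
  (forall i, 0 < z i) -> injective z ->
  (forall s, 0 < s <= s0 -> S s = s -> exists i, s = z i) ->
  invariant_measure s0 S mu -> in_hull_of_diracs z mu.
Proof.
move=> z0 zinj zfix muS.
have fnum (A : set R) : measurable A -> mu A \is a fin_num by move=> ?; exact: fin_num_measure.
have muE (A : set R) : measurable A ->
    mu A = ((fine (mu [set 0]))%:E * \d_(0%R : R) A + \sum_i (fine (mu [set z i]))%:E * \d_(z i) A)%E.
  move=> mA.
  have pt (x : R) : mu (A `&` [set x]) = ((fine (mu [set x]))%:E * \d_x A)%E.
    rewrite fineK ?fnum// diracE; have [xA|xA] := boolP (x \in A).
      by rewrite mule1 setIC (setIidl _)// => y ->; rewrite inE in xA.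
    rewrite mule0 (_ : _ `&` _ = set0) ?measure0//; apply/seteqP; split => // y [Ay] yx.
    by move: xA; rewrite -yx mem_set.
  pose Z : set R := \bigcup_(i in [set: 'I_k]) [set z i].
  have mZ : measurable Z by apply: fin_bigcup_measurable.
  have muZ : mu (A `&` Z) = (\sum_i (fine (mu [set z i]))%:E * \d_(z i) A)%E.
    rewrite setI_bigcupr measure_fin_bigcup; first last.
    - by move=> i _; exact: measurableI.
    - by move=> i j _ _ [x [[_ xi] [_ xj]]]; apply: zinj; rewrite -xi -xj.
    - exact: finite_finset.
    rewrite (_ : [set: 'I_k] = [set` index_enum 'I_k]) -?fsbig_seq ?index_enum_uniq//.
      by apply: eq_bigr => i _; exact: pt.
    by apply/seteqP; split => // i _ /=; exact: mem_index_enum.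
  transitivity (mu (A `&` [set 0%R]) + mu (A `&` Z))%E; last by congr (_ + _)%E; [exact: pt|exact: muZ].
  rewrite -measureU//; [| exact: measurableI | exact: measurableI |].
    rewrite -setIUr [LHS](measureDI _ mA (measurableU _ _ (measurable_set1 0) mZ)).
    rewrite -[RHS]add0e; congr (_ + _)%E; apply: (invariant_measure_fixed muS).
      by apply: measurableD => //; exact: measurableU.
    move=> s [As nZ] /andP[s0' s1] Ss; apply: nZ.
    have [->|sn0] := eqVneq s 0; first by left.
    have sp : 0 < s by rewrite lt_neqAle eq_sym sn0.
    have [|i ->] := zfix s _ Ss; first by rewrite sp s1.
    by right; exists i.
  apply/seteqP; split => // x [] [Ax x0] [_ [i _ xi]].
  by have := z0 i; rewrite -xi x0 ltxx.
exists (fine (mu [set 0])), (fun i => fine (mu [set z i])); split => //.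
- by rewrite fine_ge0.
- by move=> i; rewrite fine_ge0.
- have := muE setT measurableT; rewrite probability_setT diracT mule1.
  under eq_bigr do rewrite diracT mule1.
  by rewrite sumEFin -EFinD => -[].
Qed.

Lemma in_hull_invariant_measure (k : nat) (z : 'I_k -> R) (mu : probability R R) :
  0 <= s0 -> S 0 = 0 -> (forall i, 0 <= z i <= s0) -> (forall i, S (z i) = z i) ->
  in_hull_of_diracs z mu -> invariant_measure s0 S mu.
Proof.
move=> s00 S0 z0 zfix [e0 [e [e00 e_ge0 e1 muE]]]; split.
  rewrite muE// diracE mem_set ?mule1; last by rewrite /= in_itv /= lexx.
  rewrite (eq_bigr (fun i => (e i)%:E)); last first.
    by move=> i _; rewrite diracE mem_set ?mule1//= in_itv/= z0.
  by rewrite sumEFin -EFinD e1.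
move=> A mA A01; rewrite !muE//; last exact: measurable_S.
have pt (x : R) : 0 <= x <= s0 -> S x = x ->
    \d_x (`[0, s0] `&` S @^-1` A) = \d_x A :> \bar R.
  move=> x0 Sx; rewrite !diracE; congr (_%:R%:E); congr nat_of_bool.
  apply/idP/idP; rewrite !inE /=; first by case; rewrite Sx.
  by move=> Ax; split; [rewrite /= in_itv| rewrite Sx].
rewrite pt ?lexx ?s00//; congr (_ + _)%E; apply: eq_bigr => i _.
by rewrite pt.
Qed.

(** For the direct implication, invariance is tested on [[set x]]: its preimage has mass one, so it
    contains [x]. *)
Lemma dirac_invariant_measureP (x : R) : 0 <= x <= s0 ->
  invariant_measure s0 S \d_x <-> S x = x.
Proof.
have dE (A : set R) : (\d_x : probability R R) A = ((x \in A)%:R)%:E by exact: diracE.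
move=> x0; split.
  have sub : [set x] `<=` `[0, s0] by move=> _ ->; rewrite /= in_itv.
  move=> [_ /(_ [set x] (measurable_set1 _) sub)].
  rewrite !dE [x \in [set x]]mem_set// => /eqP.
  by rewrite eqe eqr_nat eqb1 => /set_mem[_ /=].
move=> Sx.
split; first by rewrite dE mem_set //= in_itv.
move=> A mA A01; rewrite !dE; congr (_%:R%:E); congr nat_of_bool.
apply/idP/idP; rewrite !inE /=; first by case; rewrite Sx.
by move=> Ax; split; [rewrite /= in_itv| rewrite Sx].
Qed.
End InvariantMeasuresOfMonotoneMaps.

(** * Increments of antiderivatives *)

Section Increments.
Context {R : realType}.
Implicit Types k : R -> R.

(* No regularity of [k] is needed: an antiderivative is provided by any solution
   of the slow equation, whose speed is not known to be continuous. *)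
Definition increment k (u1 u2 I : R) : Prop :=
  exists K : R -> R, [/\ {within `[u1, u2], continuous K},
    forall u, u1 < u < u2 -> is_derive u 1 K (k u) & I = K u2 - K u1].

Lemma increment_unique k (u1 u2 I I' : R) : u1 < u2 ->
  increment k u1 u2 I -> increment k u1 u2 I' -> I = I'.
Proof.
move=> u12 [K [Kc Kd ->]] [L [Lc Ld ->]].
have [||c _] := @MVT _ (K - L) (fun=> 0) u1 u2 u12.
- move=> x; rewrite in_itv /= => x12.
  have ? := Kd _ x12; have ? := Ld _ x12.
  by apply: is_derive_eq; rewrite subrr.
- exact: within_continuousB.
rewrite mul0r !fctE; lra.
Qed.

Lemma increment_split k (u1 u u2 I : R) : u1 < u < u2 -> increment k u1 u2 I ->
  exists I1 I2, [/\ increment k u1 u I1, increment k u u2 I2 & I = I1 + I2].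
Proof.
move=> /andP[u1u uu2] [K [Kc Kd ->]].
exists (K u - K u1), (K u2 - K u); split; last by lra.
- exists K; split => //; last first.
    by move=> v /andP[v1 v2]; apply: Kd; rewrite v1 (lt_trans v2).
  apply: continuous_subspaceW Kc; apply: subset_itvl; rewrite bnd_simp; exact: ltW.
- exists K; split => //; last first.
    by move=> v /andP[v1 v2]; apply: Kd; rewrite v2 (lt_trans _ v1).
  apply: continuous_subspaceW Kc; apply: subset_itvr; rewrite bnd_simp; exact: ltW.
Qed.

Lemma increment_lt0 k (u1 u2 I : R) : u1 < u2 ->
  (forall u, u1 < u < u2 -> k u < 0) -> increment k u1 u2 I -> I < 0.
Proof.
move=> u12 k0 [K [Kc Kd ->]].
have Kd' x : x \in `]u1, u2[ -> is_derive x 1 K (k x) by rewrite in_itv /= => /Kd.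
by have [c] := MVT u12 Kd' Kc; rewrite in_itv /= => /k0 kc ->; rewrite nmulr_rlt0// subr_gt0.
Qed.

(** Reflection moves the branch of positive parameters to negative ones and turns a positive density
    into a negative one, so only limits at [0] from the left need to be studied. *)
Lemma increment_opp k (u1 u2 I : R) :
  increment k u1 u2 I -> increment (fun u => - k (- u)) (- u2) (- u1) (- I).
Proof.
move=> [K [Kc Kd ->]]; exists (K \o -%R); split.
- by apply/within_continuous_compN; rewrite !opprK.
- move=> u /andP[u1' u2']; have Ku := Kd (- u).
  rewrite ltrNl ltrNr in Ku; have /Ku Kd' : (u < - u1) && (- u2 < u) by rewrite u2' u1'.
  have /= := is_derive1_comp Kd' (is_deriveNid u 1).
  by rewrite mulrN1.
- by rewrite !compE !opprK opprB.
Qed.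

(** The counterpart of [I_minus] in the parameter of the curve. It is a limit from one side because
    the slow equation is only available off the contact point, here at parameter [0]. *)
Definition increment_to0 k (u l : R) : Prop :=
  exists2 J : R -> R, forall t, u < t < 0 -> increment k u t (J t) &
    J t @[t --> 0^'-] --> l.

Lemma increment_to0_unique k (u l l' : R) : u < 0 ->
  increment_to0 k u l -> increment_to0 k u l' -> l = l'.
Proof.
move=> u0 [J Jk Jl] [J' Jk' Jl'].
apply: (cvg_unique (@norm_hausdorff _ R) Jl).
apply: cvg_trans Jl'; apply: near_eq_cvg; near=> t.
have tu : u < t by near: t; exact: nbhs_left_gt.
apply: (increment_unique tu); [apply: Jk'|apply: Jk].
  by rewrite tu; near: t; exact: nbhs_left_lt.
by rewrite tu; near: t; exact: nbhs_left_lt.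
Unshelve. all: by end_near. Qed.

Section Negative.
Variable k : R -> R.
Hypothesis k_lt0 : forall u, -1 < u < 0 -> k u < 0.

Lemma increment_to0_sub (u v l : R) : -1 < u -> u < v < 0 -> increment_to0 k u l ->
  exists2 c, c < 0 & increment_to0 k v (l - c).
Proof.
move=> u1 /andP[uv v0] [J Jk Jl].
have v2 : v < v / 2 < 0 by lra.
have uv2 : u < v < v / 2 by lra.
have uv2' : u < v / 2 < 0 by lra.
have [c [_ [kc _ _]]] := increment_split uv2 (Jk _ uv2').
exists c.
  by apply: (increment_lt0 uv _ kc) => w /andP[w1 w2]; apply: k_lt0; lra.
exists (fun t => J t - c); last by apply: cvgB => //; exact: cvg_cst.
move=> t /andP[vt t0]; have ut : u < t < 0 by rewrite t0 (lt_trans uv).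
have uvt : u < v < t by rewrite uv.
have [c' [d [kc' kd ->]]] := increment_split uvt (Jk t ut).
by rewrite (increment_unique uv kc' kc) addrAC subrr add0r.
Qed.

Lemma increment_to0_lt0 (u l : R) : -1 < u < 0 -> increment_to0 k u l -> l < 0.
Proof.
move=> /andP[u1 u0] kl; have u2 : u < u / 2 < 0 by lra.
(* The limit alone would give [<= 0]; strictness comes from the piece between [u] and [u / 2], which
   is split off beforehand. *)
have [c c0 [J Jk Jl]] := increment_to0_sub u1 u2 kl.
suff : l - c <= 0 by lra.
apply: (cvgr_to_le Jl); near=> t.
have ut : u / 2 < t by near: t; apply: nbhs_left_gt; lra.
have t0 : t < 0 by near: t; exact: nbhs_left_lt.
apply/ltW/(increment_lt0 ut _ (Jk t _)); last by rewrite ut.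
by move=> w /andP[w1 w2]; apply: k_lt0; lra.
Unshelve. all: by end_near. Qed.

Lemma increment_to0_inj (u v l : R) : -1 < u < 0 -> -1 < v < 0 ->
  increment_to0 k u l -> increment_to0 k v l -> u = v.
Proof.
wlog uv : u v / u < v.
  move=> H u0 v0 ul vl; have [uv|uv|//] := ltgtP u v; first exact: H.
  by apply/esym; exact: H.
move=> /andP[u1 u0] /andP[v1 v0] ul vl.
have uv0 : u < v < 0 by rewrite uv.
have [c c0 /(increment_to0_unique v0 vl)] := increment_to0_sub u1 uv0 ul.
by move: c0; lra.
Qed.

End Negative.
End Increments.

(** * Change of variable from slow time to the parameter of the curve *)

Section SlowTime.
Context {R : realType}.

Lemma is_derive_coord m n (g : R -> 'M[R]_(m, n)) (t : R) v i j :
  is_derive t 1 g v -> is_derive t 1 (fun s => g s i j) (v i j).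
Proof.
move=> [dg <-]; split; first by have /derivable_mxP := dg.
by rewrite derive_mx// mxE.
Qed.

(** In a coordinate where [v] is nonzero, the slope functions satisfy [c (phi s) * (phi s - phi t) =
    d s * (s - t)]. Continuity of [phi] keeps [c (phi s)] nonzero near [t], so the slope of [phi] is
    a quotient of continuous functions. *)
Lemma reparametrization_is_derive n (gam g : R -> 'rV[R]_n) (phi : R -> R)
    (t a : R) (v : 'rV[R]_n) :
  (\forall s \near t, gam (phi s) = g s) -> {for t, continuous phi} ->
  v != 0 -> is_derive (phi t) 1 gam v -> is_derive t 1 g (a *: v) ->
  is_derive t 1 phi a.
Proof.
move=> gamphi phic v0 dgam dg.
have [i vi] : exists i, v 0 i != 0.
  apply/existsP; apply: contraNT v0; rewrite negb_exists => /forallP v0.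
  by apply/eqP/rowP => i; rewrite mxE; apply/eqP; rewrite -[_ == _]negbK.
have /is_derive1_caratheodory[c [cE cc c0]] := is_derive_coord 0 i dgam.
have /is_derive1_caratheodory[d [dE dc d0]] := is_derive_coord 0 i dg.
pose m s := if s == t then a else (phi s - phi t) / (s - t).
apply/is_derive1_caratheodory; exists m; split.
- move=> z; rewrite /m; case: eqVneq => [->|zt]; first by rewrite !subrr mulr0.
  by rewrite divfK// subr_eq0.
- have cphi : {for t, continuous (c \o phi)} by exact: continuous_comp.
  have cphi0 : \forall s \near t, c (phi s) != 0.
    apply: (cphi [set x | x != 0]); apply: open_nbhs_nbhs; split.
      exact: open_neq.
    by rewrite /= c0.
  have dcphi : {for t, continuous (fun s => d s / c (phi s))}.
    by apply: cvgM => //; apply: cvgV => //; rewrite /= c0.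
  have mE : \forall s \near t, m s = d s / c (phi s).
    near=> s; rewrite /m; case: eqVneq => [->|st].
      by rewrite c0 d0 mxE mulfK.
    have cs0 : c (phi s) != 0 by near: s.
    have st0 : s - t != 0 by rewrite subr_eq0.
    have gs : gam (phi s) = g s by near: s.
    have gt : gam (phi t) = g t by exact: nbhs_singleton gamphi.
    have := dE s; rewrite -gs -gt cE => h.
    by rewrite -[X in X / _](mulfK cs0) (mulrC (phi s - _)) h; field; rewrite cs0.
  have mt : m t = d t / c (phi t) := nbhs_singleton mE.
  suff : m @ t --> d t / c (phi t) by rewrite -mt.
  apply: cvg_trans dcphi.
  by apply: near_eq_cvg; apply: filterS mE => s ->.
- by rewrite /m eqxx.
Unshelve. all: by end_near. Qed.

(** The parameters at distance at least [e] from [phi t] form a compact set; its image under [gam]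
    is closed and, by injectivity, misses [g t]. Hence [g s] avoids this image for [s] near [t]. *)
Lemma continuous_preimage_compact_inj (T : topologicalType) n
    (gam : R -> 'rV[R]_n) (g : T -> 'rV[R]_n) (phi : T -> R) (D : set T) (u1 u2 : R) :
  {in `[u1, u2], continuous gam} -> {in `[u1, u2] &, injective gam} ->
  {within D, continuous g} ->
  (forall t, D t -> phi t \in `[u1, u2] /\ gam (phi t) = g t) ->
  {within D, continuous phi}.
Proof.
move=> gamc gami gc phiP; apply/subspace_continuousP => t Dt.
apply/cvgrPdist_lt => e e0.
pose K : set R := `[u1, u2] `&` [set u | e <= `|phi t - u|].
have Kc : compact K.
  apply: (subclosed_compact _ (@segment_compact _ u1 u2)); last by move=> u [].
  apply: closedI; first exact: itv_closed.
  apply: (@closed_comp _ _ (fun u => `|phi t - u|) [set x | e <= x]); last exact: closed_ge.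
  by move=> x _; apply: cvg_norm; apply: cvgB; [exact: cvg_cst|exact: cvg_id].
have gK : closed (gam @` K).
  apply: compact_closed; first exact: norm_hausdorff.
  apply: continuous_compact Kc; apply: continuous_in_subspaceT => u.
  by rewrite inE => -[uI _]; exact: gamc.
have [phit gphit] := phiP _ Dt.
have gtK : (~` (gam @` K)) (g t).
  move=> [u [/= uI eu]]; rewrite -gphit => /(gami _ _ uI phit) uE.
  by move: eu; rewrite uE subrr normr0 leNgt e0.
have := (subspace_continuousP _ _).1 gc t Dt _ (open_nbhs_nbhs (conj (closed_openC gK) gtK)).
move=> near_g; near=> s.
have Ds : D s by near: s; exact: withinT.
have [phis gphis] := phiP _ Ds.
rewrite ltNge; apply/negP => es.
have : (~` (gam @` K)) (g s) by near: s.
by apply; exists (phi s) => //; split.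
Unshelve. all: by end_near. Qed.

Lemma within_continuous_comp_sub (A B : set R) (f g : R -> R) :
  {within A, continuous f} -> (forall x, A x -> B (f x)) ->
  {within B, continuous g} -> {within A, continuous (g \o f)}.
Proof.
move=> fc fAB gc; apply/subspace_continuousP => x Ax.
apply: (@cvg_comp _ _ _ f g _ (within B (nbhs (f x)))); last first.
  exact: (subspace_continuousP _ _).1 gc _ (fAB _ Ax).
move=> W /= BW; have := (subspace_continuousP _ _).1 fc _ Ax _ BW => near_f.
near=> y; have Ay : A y by near: y; exact: withinT.
have BWf : B (f y) -> W (f y) by near: y.
by apply: BWf; exact: fAB.
Unshelve. all: by end_near. Qed.

(** [phi] is the parameter of [gam] reached at slow time [t]. The slow equation gives it the
    derivative [a (phi t) > 0], so it has an inverse [psi] with derivative [(a u)^-1]. The primitive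
    [Phi] of the divergence in slow time, composed with [psi], is the required antiderivative;
    continuity of [a] is not assumed. *)
Lemma slow_divergence_increment (X Qh : 'rV[R]_2 -> 'rV[R]_2) gam (a : R -> R) (u1 u2 I : R) :
  u1 < u2 ->
  (forall u, u \in `[u1, u2] -> derivable gam u 1 /\ 'D_1 gam u != 0) ->
  {in `[u1, u2] &, injective gam} ->
  (forall u, u \in `[u1, u2] -> 0 < a u /\ Qh (gam u) = a u *: 'D_1 gam u) ->
  (forall u, u \in `[u1, u2] -> {for gam u, continuous (eigval X)}) ->
  slow_divergence_integral X Qh gam u1 u2 I ->
  increment (fun u => eigval X (gam u) / a u) u1 u2 I.
Proof.
move=> u12 gamd gami aP Xc [t1 [t2 [g [[t12 gc] gd gim [g1 g2] ->]]]].
have gamc : {in `[u1, u2], continuous gam}.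
  by move=> u uI; apply/differentiable_continuous/derivable1_diffP; have [] := gamd _ uI.
pose phi t := xget 0 [set u | u \in `[u1, u2] /\ gam u = g t].
have phiP t : t \in `[t1, t2] -> phi t \in `[u1, u2] /\ gam (phi t) = g t.
  move=> tI; apply: (@xgetPex _ 0 [set u | u \in `[u1, u2] /\ gam u = g t]).
  have : (g @` `[t1, t2]) (g t) by exists t.
  by rewrite gim => -[u uI gu]; exists u; split.
have phic : {within `[t1, t2], continuous phi}.
  exact: continuous_preimage_compact_inj gamc gami gc phiP.
have t1I : t1 \in `[t1, t2] by rewrite bound_itvE ltW.
have t2I : t2 \in `[t1, t2] by rewrite bound_itvE ltW.
have u1I : u1 \in `[u1, u2] by rewrite bound_itvE ltW.
have u2I : u2 \in `[u1, u2] by rewrite bound_itvE ltW.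
have phi1 : phi t1 = u1.
  by have [? ?] := phiP _ t1I; apply: gami => //; rewrite -g1.
have phi2 : phi t2 = u2.
  by have [? ?] := phiP _ t2I; apply: gami => //; rewrite -g2.
have phid t : t \in `]t1, t2[ -> is_derive t 1 phi (a (phi t)).
  move=> tI; have tI' := subset_itv_oo_cc tI.
  have [pI gp] := phiP _ tI'; have [a0 aE] := aP _ pI; have [dgam gam0] := gamd _ pI.
  have gphi : \forall s \near t, gam (phi s) = g s.
    near=> s; have sI : s \in `]t1, t2[ by near: s; exact: near_in_itvoo.
    by have [] := phiP _ (subset_itv_oo_cc sI).
  have phict : {for t, continuous phi} by exact: within_continuous_continuous t12 phic tI.
  have dg : is_derive t 1 g (a (phi t) *: 'D_1 gam (phi t)).
    by rewrite -aE gp; apply: gd; rewrite in_itv in tI.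
  exact: (reparametrization_is_derive gphi phict gam0 (derivableP dgam) dg).
have phi_lt : {in `[t1, t2] &, {homo phi : x y / x < y}}.
  move=> x y xI yI xy.
  have phixy : {within `[x, y], continuous phi}.
    apply: continuous_subspaceW phic; apply: subset_itv; rewrite bnd_simp.
      by rewrite (itvP xI).
    by rewrite (itvP yI).
  have sub z : z \in `]x, y[ -> z \in `]t1, t2[.
    rewrite !in_itv /= => /andP[xz zy].
    by rewrite (le_lt_trans _ xz) ?(itvP xI)// (lt_le_trans zy) ?(itvP yI).
  have phixyd z : z \in `]x, y[ -> is_derive z 1 phi (a (phi z)) by move/sub/phid.
  have [c cI E] := MVT xy phixyd phixy.
  rewrite -subr_gt0 E mulr_gt0 ?subr_gt0//.
  by have [/aP[]] := phiP _ (subset_itv_oo_cc (sub _ cI)).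
have phi_le : {in `[t1, t2] &, {mono phi : x y / x <= y}} by exact: le_mono_in.
have phi_inj : {in `[t1, t2] &, injective phi} by exact: inc_inj_in.
pose psi u := xget t1 [set t | t \in `[t1, t2] /\ phi t = u].
have psiP u : u \in `[u1, u2] -> psi u \in `[t1, t2] /\ phi (psi u) = u.
  move=> uI; apply: (@xgetPex _ t1 [set t | t \in `[t1, t2] /\ phi t = u]).
  have minmax : Num.min (phi t1) (phi t2) <= u <= Num.max (phi t1) (phi t2).
    rewrite phi1 phi2 (min_l (ltW u12)) (max_r (ltW u12)).
    by rewrite in_itv in uI.
  by have [t tI tu] := IVT (ltW t12) phic minmax; exists t.
have phiK : {in `[t1, t2], cancel phi psi}.
  move=> t tI; have [pI _] := phiP _ tI; have [? ?] := psiP _ pI.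
  exact: phi_inj.
have psic : {within `[u1, u2], continuous psi}.
  by rewrite -phi1 -phi2; apply: segment_can_le_continuous => //; exact: ltW.
have psi1 : psi u1 = t1 by rewrite -phi1 phiK.
have psi2 : psi u2 = t2 by rewrite -phi2 phiK.
have psid u : u \in `]u1, u2[ -> (psi u \in `]t1, t2[) /\ is_derive u 1 psi (a u)^-1.
  move=> uI; have uI' := subset_itv_oo_cc uI; have [pI phipsi] := psiP _ uI'.
  have pI' : psi u \in `]t1, t2[.
    move: uI; rewrite !in_itv /= -phi1 -phi2 -{1 2}phipsi => /andP[h1 h2].
    by rewrite -(leW_mono_in phi_le t1I pI) h1 -(leW_mono_in phi_le pI t2I) h2.
  split => //; rewrite -{1}phipsi.
  apply: is_derive_inverse.
  - near=> s; apply: phiK; apply: subset_itv_oo_cc; near: s; exact: near_in_itvoo.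
  - near=> s; apply: (within_continuous_continuous t12 phic); near: s; exact: near_in_itvoo.
  - by have := phid _ pI'; rewrite phipsi.
  - by have [a0 _] := aP _ uI'; rewrite gt_eqF.
pose h := eigval X \o g.
have hc : {within `[t1, t2], continuous h}.
  apply: within_continuous_comp gc => z; rewrite inE gim => -[u uI <-]; exact: Xc.
have hint : lebesgue_measure.-integrable `[t1, t2] (EFin \o h).
  by apply: continuous_compact_integrable => //; exact: segment_compact.
pose Phi s := \int[lebesgue_measure]_(t in `[t1, s]) h t.
have Phic : {within `[t1, t2], continuous Phi}.
  exact: parameterized_integral_continuous (ltW t12) hint.
exists (Phi \o psi); split.
- apply: (within_continuous_comp_sub psic _ Phic) => u uI.
  by have [] := psiP _ uI.
- move=> u u0; have uI : u \in `]u1, u2[ by rewrite in_itv.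
  have [pI dpsi] := psid _ uI.
  have t1psi : t1 < psi u by rewrite (itvP pI).
  have psit2 : psi u < t2 by rewrite (itvP pI).
  have hcu := within_continuous_continuous t12 hc pI.
  have [dPhi PhiE] := continuous_FTC1_closed psit2 hint t1psi hcu.
  have dPhi' : is_derive (psi u) 1 Phi (h (psi u)).
    by split; [exact: dPhi|rewrite -derive1E PhiE].
  have hE : h (psi u) = eigval X (gam u).
    have [_ phipsi] := psiP _ (subset_itv_oo_cc uI).
    have [_ gE] := phiP _ (subset_itv_oo_cc pI).
    rewrite [LHS](_ : _ = eigval X (gam (phi (psi u)))); last by rewrite gE.
    by congr (eigval X (gam _)).
  by rewrite -hE; exact: is_derive1_comp dPhi' dpsi.
- transitivity (Phi t2 - Phi t1); last by congr (Phi _ - Phi _).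
  rewrite /Phi set_itv1 Rintegral_set1 subr0; reflexivity.
Unshelve. all: by end_near. Qed.
End SlowTime.

(** * Directional derivatives *)

Lemma cvg_sum_ord (R : realType) (W : normedModType R) n (T : Type) (F : set_system T)
    (FF : Filter F) (f : 'I_n -> T -> W) (l : 'I_n -> W) :
  (forall i, f i t @[t --> F] --> l i) -> \sum_i f i t @[t --> F] --> \sum_i l i.
Proof. by move=> fl; apply: cvg_big => [|i _]; [exact: add_continuous|exact: fl]. Qed.

Section Calculus.
Context {R : realType}.

Lemma is_derive_curve (V W : normedModType R) (f : V -> W) (x : R -> V) (t : R) v :
  differentiable f (x t) -> is_derive t 1 x v ->
  is_derive t 1 (f \o x) ('D_v f (x t)).
Proof.
move=> df [dx xv].
have dx' : differentiable x t by exact/derivable1_diffP.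
have dfx : differentiable (f \o x) t by exact: differentiable_comp.
split; first exact/derivable1_diffP.
have xv' : 'd x t 1 = v by rewrite -deriveE.
by rewrite deriveE// diff_comp//= xv' deriveE.
Qed.

Lemma derive_comp (V W Z : normedModType R) (f : V -> W) (g : W -> Z) x v :
  differentiable f x -> differentiable g (f x) ->
  'D_v (g \o f) x = 'D_('D_v f x) g (f x).
Proof.
move=> df dg; have dgf : differentiable (g \o f) x by exact: differentiable_comp.
by rewrite [in RHS]deriveE// [in RHS]deriveE// deriveE// diff_comp.
Qed.

Lemma deriveZv (V W : normedModType R) (f : V -> W) x a v : differentiable f x ->
  'D_(a *: v) f x = a *: 'D_v f x.
Proof. by move=> df; rewrite !deriveE// linearZ. Qed.

Lemma deriveNv (V W : normedModType R) (f : V -> W) x v : differentiable f x ->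
  'D_(- v) f x = - 'D_v f x.
Proof. by move=> df; rewrite !deriveE// linearN. Qed.

Lemma derive_row_sum n (W : normedModType R) (f : 'rV[R]_n -> W) x v :
  differentiable f x ->
  'D_v f x = \sum_j v 0 j *: 'D_(delta_mx 0 j) f x.
Proof.
move=> df; rewrite deriveE// {1}(row_sum_delta v) linear_sum/=.
by apply: eq_bigr => j _; rewrite linearZ/= deriveE.
Qed.

(** The derivative is continuous for each fixed direction only; expanding the moving direction in
    the canonical basis reduces the claim to finitely many fixed ones. *)
Lemma cvg_derive n (W : normedModType R) (f : 'rV[R]_n -> W) (T : Type)
    (F : set_system T) {FF : Filter F} (x v : T -> 'rV[R]_n) p w :
  (\forall q \near p, differentiable f q) ->
  (forall w, {for p, continuous ('D_w f)}) ->
  x i @[i --> F] --> p -> v i @[i --> F] --> w ->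
  'D_(v i) f (x i) @[i --> F] --> 'D_w f p.
Proof.
move=> df cDf xp vw; rewrite derive_row_sum; last exact: nbhs_singleton df.
have : \sum_j v i 0 j *: 'D_(delta_mx 0 j) f (x i) @[i --> F] -->
    \sum_j w 0 j *: 'D_(delta_mx 0 j) f p.
  apply: cvg_sum_ord => j; apply: cvgZ.
    exact: (@cvg_comp _ _ _ v (fun u : 'rV[R]_n => u 0 j) _ _ _ vw (@coord_continuous _ _ _ 0 j w)).
  exact: (@cvg_comp _ _ _ x ('D_(delta_mx 0 j) f) _ _ _ xp (cDf _)).
apply: cvg_trans; apply: near_eq_cvg => /=.
have : \forall i \near F, differentiable f (x i) by exact: (xp _ df).
by apply: filterS => i dfi; rewrite (derive_row_sum (v i)).
Qed.

Lemma MVT_ray (V : normedModType R) (f : V -> R) (a b : V) :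
  (forall t : R, 0 <= t <= 1 -> differentiable f (a + t *: (b - a))) ->
  exists2 t : R, 0 < t < 1 & f b - f a = 'D_(b - a) f (a + t *: (b - a)).
Proof.
move=> df; pose x (t : R) := a + t *: (b - a).
have dx (t : R) : is_derive t 1 x (b - a).
  have : is_derive t 1 (fun s : R => s *: (b - a)) (b - a).
    have [ds dsE] := is_diff_scalel t (b - a).
    by split; [exact/derivable1_diffP|rewrite deriveE// dsE scale1r].
  by move=> ds; apply: is_derive_eq; rewrite add0r.
have dfx (t : R) : 0 <= t <= 1 -> is_derive t 1 (f \o x) ('D_(b - a) f (x t)).
  by move=> tI; apply: is_derive_curve (dx t); exact: df.
have [||t tI] := @MVT _ (f \o x) (fun t => 'D_(b - a) f (x t)) 0 1 ltr01.
- by move=> t tI; apply: dfx; rewrite !(itvP tI).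
- apply: continuous_in_subspaceT => t; rewrite inE/= in_itv/= => tI.
  by apply/differentiable_continuous/derivable1_diffP; have [] := dfx _ tI.
rewrite /comp /x scale0r scale1r addr0 subrKC subr0 mulr1 => E.
by exists t => //; rewrite in_itv in tI.
Qed.

Lemma derive_le0_nonincreasing (f df : R -> R) (a b : R) : a <= b ->
  (forall t, a <= t <= b -> {for t, continuous f}) ->
  (forall t, a < t < b -> is_derive t 1 f (df t)) ->
  (forall t, a < t < b -> df t <= 0) -> f b <= f a.
Proof.
rewrite le_eqVlt => /predU1P[->//|ab] cf fd df0.
have fc : {within `[a, b], continuous f}.
  by apply: continuous_in_subspaceT => t; rewrite inE/= in_itv/= => /cf.
have fd' t : t \in `]a, b[ -> is_derive t 1 f (df t) by rewrite in_itv => /fd.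
have [c] := MVT ab fd' fc; rewrite in_itv /= => /df0 dfc E.
by rewrite -subr_le0 E mulr_le0_ge0// subr_ge0 ltW.
Qed.

(** A bootstrap principle for estimates that hold only as long as an orbit stays in a ball. The
    infimum of the bad times is good by [step], hence so is a neighbourhood of it, which contradicts
    its being the infimum. *)
Lemma continuous_stay_below (f : R -> R) (r a b : R) :
  (forall t, a <= t <= b -> {for t, continuous f}) ->
  (forall t, a <= t <= b -> (forall s, a <= s < t -> f s < r) -> f t < r) ->
  forall t, a <= t <= b -> f t < r.
Proof.
move=> fc step t tI; rewrite ltNge; apply/negP => rft.
pose A := [set s | a <= s <= b /\ r <= f s].
have Ai : has_inf A.
  by split; [exists t|exists a => s [/andP[]]].
have A0 : A !=set0 by exists t.
have aA : a <= inf A by apply: lb_le_inf => // s [/andP[]].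
have Ab : inf A <= b.
  by apply: (@le_trans _ _ t); [apply: ge_inf; [exact: Ai.2|]|case/andP: tI].
have AI : a <= inf A <= b by rewrite aA.
have fA : f (inf A) < r.
  apply: step => // s /andP[as_ sA]; rewrite ltNge; apply/negP => rfs.
  have : inf A <= s.
    by apply: ge_inf; [exact: Ai.2|split => //; rewrite as_ ltW// (lt_le_trans sA)].
  by rewrite leNgt sA.
have /nbhs_ballP[e /= e0 eA] : \forall s \near inf A, f s < r.
  have := fc _ AI [set y | y < r]; apply; apply: open_nbhs_nbhs.
  by split => //; exact: open_lt.
have : inf A + e <= inf A.
  apply: lb_le_inf => // s As; rewrite leNgt; apply/negP => se.
  have : f s < r.
    apply: eA; rewrite /ball/= ltr_norml; have := ge_inf Ai.2 As; lra.
  by rewrite ltNge; case: As => _ ->.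
by rewrite gerDl leNgt e0.
Qed.

Lemma coord_norm_le n (v : 'rV[R]_n) i : `|v 0 i| <= `|v|.
Proof. by rewrite [leRHS]/Num.Def.normr/= mx_normrE; exact: (le_bigmax _ _ (0, i)). Qed.

Lemma row_norm_le n (v : 'rV[R]_n) c : 0 <= c -> (forall i, `|v 0 i| <= c) -> `|v| <= c.
Proof.
move=> c0 vc; rewrite [leLHS]/Num.Def.normr/= mx_normrE; apply: bigmax_le => // -[i j] _.
by rewrite (ord1 i).
Qed.

Lemma differentiable_coord_comp (V : normedModType R) m n (f : V -> 'M[R]_(m, n)) x i j :
  differentiable f x -> differentiable (fun y => f y i j) x.
Proof.
by move=> df; apply: (@differentiable_comp _ _ _ _ f (fun M : 'M[R]_(m, n) => M i j));
  [|exact: differentiable_coord].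
Qed.

Lemma derive_coord (V : normedModType R) m n (f : V -> 'M[R]_(m, n)) x v i j :
  differentiable f x -> 'D_v (fun y => f y i j) x = ('D_v f x) i j.
Proof. by move=> df; rewrite derive_mx ?mxE//; exact: diff_derivable. Qed.

Lemma ball_ray (V : normedModType R) (p a b : V) (r t : R) :
  ball p r a -> ball p r b -> 0 <= t <= 1 -> ball p r (a + t *: (b - a)).
Proof.
rewrite -!ball_normE /ball_/= => pa pb /andP[t0 t1].
have -> : p - (a + t *: (b - a)) = (1 - t) *: (p - a) + t *: (p - b).
  rewrite opprD addrA scalerBl scale1r -[RHS]addrA; congr (_ + _).
  by rewrite addrC -scalerBr -scalerN opprB [in RHS]opprB [in RHS]addrC subrKA.
have [->|t0'] := eqVneq t 0; first by rewrite subr0 scale1r scale0r addr0.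
rewrite (le_lt_trans (ler_normD _ _))// !normrZ (ger0_norm t0) ger0_norm ?subr_ge0//.
have tp : 0 < t by rewrite lt_neqAle eq_sym t0'.
have : (1 - t) * `|p - a| <= (1 - t) * r by rewrite ler_wpM2l ?subr_ge0// ltW.
have : t * `|p - b| < t * r by rewrite ltr_pM2l.
lra.
Qed.

Lemma locally_lipschitz m n (f : 'rV[R]_m -> 'rV[R]_n) p :
  (\forall q \near p, differentiable f q) -> (forall w, {for p, continuous ('D_w f)}) ->
  exists L r : R, [/\ 0 < L, 0 < r &
    forall a b, ball p r a -> ball p r b -> `|f a - f b| <= L * `|a - b|].
Proof.
(* The margin [1] lets continuity carry the bound on each partial derivative to a neighbourhood; the
   extra [1] in the Lipschitz constant makes it positive even when [m = 0]. *)
move=> df cDf; pose B (j : 'I_m) := `|'D_(delta_mx 0 j) f p| + 1.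
have B0 j : 0 <= B j by rewrite addr_ge0.
have : \forall q \near p, forall j : 'I_m, `|'D_(delta_mx 0 j) f q| <= B j.
  have := @filter_forall _ _ (fun (j : 'I_m) q => `|'D_(delta_mx 0 j) f q| <= B j) _ (nbhs_filter p).
  apply=> j; apply: (@cvgr_norm_le _ _ _ _ (nbhs_filter p) _ _ (cDf (delta_mx 0 j))).
  by rewrite ltrDl.
move=> /(filterI df) /nbhs_ballP[r r0 rP].
exists (\sum_j B j + 1), r; split => //.
  by rewrite ltr_wpDl// sumr_ge0.
move=> a b pa pb; apply: row_norm_le.
  by rewrite mulr_ge0// addr_ge0// sumr_ge0.
move=> i; rewrite !mxE (distrC (f a 0 i)) (distrC a).
have [|t /andP[t0 t1]] := @MVT_ray _ (fun x => f x 0 i) a b.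
  by move=> t tI; apply: differentiable_coord_comp; have [] := rP _ (ball_ray pa pb tI).
have [dfq Bq] := rP _ (ball_ray pa pb (introT andP (conj (ltW t0) (ltW t1)))).
rewrite derive_coord// => ->.
apply: le_trans (coord_norm_le _ _) _; rewrite derive_row_sum//.
apply: le_trans (ler_norm_sum _ _ _) _.
apply: (@le_trans _ _ (\sum_j B j * `|b - a|)).
  apply: ler_sum => j _; by rewrite normrZ mulrC ler_pM//; exact: coord_norm_le.
by rewrite -mulr_suml ler_wpM2r// lerDl.
Qed.

End Calculus.

(** * Foliated charts *)

Lemma nbhsI (T : topologicalType) (x : T) (A B : set T) :
  nbhs x A -> nbhs x B -> nbhs x (A `&` B).
Proof. exact: filterI. Qed.

Section C1.
Context {R : realType}.

(** A pointwise form of class C^1: differentiability on a neighbourhood, but continuity of the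
    derivatives at [x] alone. The property on a neighbourhood is written with [\near]. *)
Definition C1_at (V W : normedModType R) (f : V -> W) (x : V) : Prop :=
  (\forall y \near x, differentiable f y) /\ forall v, {for x, continuous ('D_v f)}.

Lemma smooth_on_C1 (V W : normedModType R) (A : set V) (f : V -> W) x :
  smooth_on A f -> A x -> \forall y \near x, C1_at f y.
Proof.
move=> [U [oU AU Uf]] Ax; have [Ud Uc] := Uf 1%N.
have nU : \forall y \near x, U y by exact: open_nbhs_nbhs (conj oU (AU _ Ax)).
apply: filterS nU => y Uy; split; last by move=> v; exact: Uc.
have : \forall z \near y, U z by exact: open_nbhs_nbhs (conj oU Uy).
exact: filterS.
Qed.

Lemma smooth_on_C1_at (V W : normedModType R) (A : set V) (f : V -> W) x :
  smooth_on A f -> A x -> C1_at f x.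
Proof. by move=> fA Ax; exact: nbhs_singleton (smooth_on_C1 fA Ax). Qed.

Lemma C1_at_diff (V W : normedModType R) (f : V -> W) x : C1_at f x -> differentiable f x.
Proof. by move=> [/nbhs_singleton]. Qed.

Lemma C1_at_continuous (V W : normedModType R) (f : V -> W) x :
  C1_at f x -> {for x, continuous f}.
Proof. by move=> /C1_at_diff /differentiable_continuous. Qed.

Lemma C1_at_nbhs (V W : normedModType R) (f : V -> W) x (P : set W) :
  C1_at f x -> nbhs (f x) P -> nbhs x (f @^-1` P).
Proof. by move=> /C1_at_continuous fc; exact: fc. Qed.

Lemma C1_at_coord (V : normedModType R) m n (f : V -> 'M[R]_(m, n)) i j x :
  C1_at f x -> C1_at (fun y => f y i j) x.
Proof.
move=> [df cf]; split.
  by apply: filterS df => y; exact: differentiable_coord_comp.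
move=> v; have fE : \forall y \near x, ('D_v f y) i j = 'D_v (fun y => f y i j) y.
  by apply: filterS df => y dfy; rewrite derive_coord.
have : (fun y => ('D_v f y) i j) y @[y --> x] --> ('D_v f x) i j.
  exact: (@cvg_comp _ _ _ ('D_v f) (fun u : 'M[R]_(m, n) => u i j) _ _ _ (cf v) (@coord_continuous _ _ _ i j _)).
rewrite (nbhs_singleton fE : _ = _) => cfij; rewrite /prop_for /continuous_at.
by apply: cvg_trans cfij; apply: near_eq_cvg.
Qed.

Lemma cvg_derive_C1 n (W : normedModType R) (f : 'rV[R]_n -> W) (T : Type)
    (F : set_system T) {FF : Filter F} (x v : T -> 'rV[R]_n) p w :
  C1_at f p -> x i @[i --> F] --> p -> v i @[i --> F] --> w ->
  'D_(v i) f (x i) @[i --> F] --> 'D_w f p.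
Proof. by move=> [df cf]; exact: cvg_derive. Qed.

Lemma derive_comp_continuous (V : normedModType R) n (W : normedModType R)
    (f : V -> 'rV[R]_n) (g : 'rV[R]_n -> W) x v :
  C1_at f x -> C1_at g (f x) -> {for x, continuous ('D_v (g \o f))}.
Proof.
move=> fx gx; have cf := C1_at_continuous fx.
have E : \forall y \near x, 'D_('D_v f y) g (f y) = 'D_v (g \o f) y.
  have dgf : \forall y \near x, differentiable g (f y) by exact: cf _ gx.1.
  by apply: filterS2 fx.1 dgf => y dfy dgy; exact: esym (derive_comp v dfy dgy).
rewrite /prop_for /continuous_at -(nbhs_singleton E : _ = _).
have : 'D_('D_v f y) g (f y) @[y --> x] --> 'D_('D_v f x) g (f x).
  exact: (@cvg_derive_C1 _ _ _ _ (nbhs x) _ f ('D_v f) _ _ gx cf (fx.2 v)).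
by apply: cvg_trans; apply: near_eq_cvg.
Qed.

Lemma locally_injective (f : R -> R) x : (\forall y \near x, differentiable f y) ->
  {for x, continuous ('D_1 f)} -> 'D_1 f x != 0 ->
  exists2 B, nbhs x B & {in B &, injective f}.
Proof.
move=> df cf f0.
have n0 : \forall y \near x, 'D_1 f y != 0.
  have := cf [set z | z != 0]; apply; apply: open_nbhs_nbhs.
  by split => //; exact: open_neq.
have nb : nbhs x [set y | differentiable f y /\ 'D_1 f y != 0] by exact: filterI.
have /nbhs_ballP[e /= e0 eP] := nb.
exists (ball x e); first exact: nbhsx_ballx.
move=> a b; rewrite !inE => xa xb fab.
have [|t /andP[t0 t1]] := @MVT_ray _ _ f a b.
  by move=> t tI; have [] := eP _ (ball_ray xa xb tI).
have [dft nt] := eP _ (ball_ray xa xb (introT andP (conj (ltW t0) (ltW t1)))).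
rewrite fab subrr => /esym.
rewrite (_ : 'D_(b - a) f _ = (b - a) *: 'D_1 f (a + t *: (b - a))); last first.
  by rewrite -deriveZv//; congr ('D__ f _); rewrite [RHS]mulr1.
move=> /eqP; rewrite scaler_eq0 (negbTE nt) orbF subr_eq0.
by move=> /eqP.
Qed.

End C1.

Section Charts.
Context {R : realType}.
Local Notation plane := 'rV[R]_2.
Implicit Types (M : set plane) (c : @fol_chart R).

Lemma transverse_coord_C1 M c p : is_fol_chart M c -> fdom c p ->
  \forall q \near p, C1_at (transverse_coord c) q.
Proof.
move=> [_ cS _ _ _] cp; have := smooth_on_C1 cS cp.
by apply: filterS => q; exact: C1_at_coord.
Qed.

Lemma derive_transverse_coord M c p v : is_fol_chart M c -> fdom c p ->
  'D_v (transverse_coord c) p = ('D_v (fcoord c) p) 0 1.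
Proof.
move=> [_ cS _ _ _] cp; rewrite -derive_coord//.
exact: C1_at_diff (smooth_on_C1_at cS cp).
Qed.

Lemma open_square : open (@square R).
Proof.
rewrite openE => z zS.
have := @filter_forall _ _ (fun i (y : plane) => -1 < y 0 i < 1) _ (nbhs_filter z).
apply=> i; have zi : `]-1, 1[%classic (z 0 i) by rewrite /= in_itv; exact: zS.
have oI : open (`]-1, 1[%classic : set R) by exact: interval_open.
have := @coord_continuous _ 1 2 0 i z _ (open_nbhs_nbhs (conj oI zi)).
by apply: (@filterS _ _ (nbhs_filter z)) => y /=; rewrite in_itv.
Qed.

Lemma derive_coord_of_inverse M c z v : is_fol_chart M c -> square z ->
  'D_('D_v (finvc c) z) (fcoord c) (finvc c z) = v.
Proof.
move=> [_ cS iS _ ci] zS; have [iz _] := ci _ zS.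
have di := C1_at_diff (smooth_on_C1_at iS zS).
have dc := C1_at_diff (smooth_on_C1_at cS iz).
rewrite -derive_comp// (@near_eq_derive _ _ _ _ id).
  by rewrite derive_id.
apply: filterS (open_nbhs_nbhs (conj open_square zS)) => y /ci[_].
by [].
Qed.

Lemma derive_inverse_of_coord M c p v : is_fol_chart M c -> fdom c p ->
  'D_('D_v (fcoord c) p) (finvc c) (fcoord c p) = v.
Proof.
move=> [[oc _] cS iS ci _] cp; have [zS _] := ci _ cp.
have di := C1_at_diff (smooth_on_C1_at iS zS).
have dc := C1_at_diff (smooth_on_C1_at cS cp).
rewrite -derive_comp// (@near_eq_derive _ _ _ _ id).
  by rewrite derive_id.
by apply: filterS (open_nbhs_nbhs (conj oc cp)) => y /ci[_].
Qed.

(** In the coordinates of [c], the segment joining two points of one plaque is horizontal, and along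
    it the transverse coordinate of [c'] has zero derivative. [N] comes from a ball, so that by
    convexity the segment stays in both domains. *)
Lemma chart_change M A c c' p : is_foliation M A -> A c -> A c' ->
  fdom c p -> fdom c' p ->
  exists2 N, nbhs p N & forall a b, N a -> N b ->
    transverse_coord c a = transverse_coord c b ->
    transverse_coord c' a = transverse_coord c' b.
Proof.
move=> [Ac _ Acc] c_ c'_ cp c'p.
have cC := Ac _ c_; have [[oc _] cS iS ci ci'] := cC.
have c'C := Ac _ c'_; have [[oc' _] c'S _ _ _] := c'C.
have [zS zi] := ci _ cp.
have di := C1_at_continuous (smooth_on_C1_at iS zS).
have nS : \forall z \near fcoord c p, square z /\ fdom c' (finvc c z).
  apply: filterI; first exact: open_nbhs_nbhs (conj open_square zS).
  by apply: di; rewrite zi; exact: open_nbhs_nbhs.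
have /nbhs_ballP[r /= r0 rP] := nS.
exists (fdom c `&` fcoord c @^-1` ball (fcoord c p) r).
  apply: filterI; first exact: open_nbhs_nbhs.
  apply: (C1_at_continuous (smooth_on_C1_at cS cp)); exact: nbhsx_ballx.
move=> a b [ca za] [cb zb] hab.
have [t tI|t /andP[t0 t1]] := @MVT_ray _ _ (transverse_coord c' \o finvc c) (fcoord c a) (fcoord c b).
  have [zt c't] := rP _ (ball_ray za zb tI).
  apply: differentiable_comp; first exact: C1_at_diff (smooth_on_C1_at iS zt).
  exact: C1_at_diff (nbhs_singleton (transverse_coord_C1 c'C c't)).
have tI : 0 <= t <= 1 by rewrite !ltW.
have [zt c't] := rP _ (ball_ray za zb tI).
have dit := C1_at_diff (smooth_on_C1_at iS zt).
have dht := C1_at_diff (nbhs_singleton (transverse_coord_C1 c'C c't)).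
rewrite derive_comp// (Acc c c' _ _ c_ c'_ _ c't).
- rewrite /= (ci _ ca).2 (ci _ cb).2 => /eqP; rewrite subr_eq0 => /eqP ->; done.
- exact: (ci' _ zt).1.
- rewrite (derive_transverse_coord _ cC); last exact: (ci' _ zt).1.
  rewrite (derive_coord_of_inverse _ cC)// !mxE.
  by move: hab; rewrite /transverse_coord => ->; rewrite subrr.
Qed.

(* On a plaque through a point where [F] has nonzero derivative along the
   leaf, [F] is strictly monotone. *)
Lemma plaque_injective M A c p (F : plane -> R) (v : plane) : is_foliation M A -> A c ->
  fdom c p -> (\forall q \near p, C1_at F q) -> leaf_tangent A p v -> 'D_v F p != 0 ->
  exists2 N, nbhs p N & forall a b, N a -> N b ->
    transverse_coord c a = transverse_coord c b -> F a = F b -> a = b.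
Proof.
move=> [Ac _ _] c_ cp F1 vt Fv.
have cC := Ac _ c_; have [[oc _] cS iS ci ci'] := cC.
have [zS zi] := ci _ cp.
pose f := F \o finvc c; pose e0 : plane := delta_mx 0 0.
have cpc (r : R) : 0 < r -> nbhs p (fcoord c @^-1` ball (fcoord c p) r).
  by move=> r0; apply: (C1_at_continuous (smooth_on_C1_at cS cp)); exact: nbhsx_ballx.
have invD := derive_inverse_of_coord v cC cp.
move: zS zi cpc invD; move: {1 2 3 4}(fcoord c p) => z zS zi cpc invD.
have iz := smooth_on_C1_at iS zS; have Fp := nbhs_singleton F1.
have rowE (w : plane) : w 0 1 = 0 -> w = w 0 0 *: e0.
  move=> w1; apply/rowP => i; rewrite !mxE eqxx /=.
  case: i => -[|[|//]] i /=.
    by rewrite mulr1; congr (w _ _); exact: val_inj.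
  by rewrite mulr0 -w1; congr (w _ _); exact: val_inj.
have Fz : C1_at F (finvc c z) by rewrite zi.
have df_z : differentiable f z.
  exact: differentiable_comp (C1_at_diff iz) (C1_at_diff Fz).
have fe0 : 'D_e0 f z != 0.
  (* [w] is the vector [v] read in the chart. Being tangent to the leaf, it is a multiple of [e0],
     so a zero derivative along [e0] would kill the derivative of [F] along [v]. *)
  apply: contraNneq Fv => fe0; pose w := 'D_v (fcoord c) p.
  have <- : 'D_w f z = 'D_v F p.
    rewrite (derive_comp w (C1_at_diff iz) (C1_at_diff Fz)).
    by rewrite invD zi.
  have -> : w = w 0 0 *: e0.
    by apply: rowE; rewrite -(derive_transverse_coord v cC cp); exact: vt.
  by rewrite deriveZv// fe0 scaler0.
have FN : nbhs (finvc c z) (C1_at F) by rewrite zi.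
have n1 : nbhs z (@square R) by exact: open_nbhs_nbhs (conj open_square zS).
have n2 : nbhs z (finvc c @^-1` C1_at F) by apply: (C1_at_nbhs iz FN).
have n3 : nbhs z ('D_e0 f @^-1` [set x | x != 0]).
  apply: (derive_comp_continuous iz Fz); apply: open_nbhs_nbhs.
  by split => //; exact: open_neq.
have /nbhs_ballP[r /= r0 rP] := nbhsI n1 (nbhsI n2 n3).
exists (fdom c `&` fcoord c @^-1` ball z r).
  apply: nbhsI; first exact: open_nbhs_nbhs.
  exact: cpc.
move=> a b [ca za] [cb zb] hab Fab.
have df (t : R) : 0 <= t <= 1 -> differentiable f (fcoord c a + t *: (fcoord c b - fcoord c a)).
  move=> tI; have [zt [Ft _]] := rP _ (ball_ray za zb tI).
  apply: differentiable_comp; first exact: C1_at_diff (smooth_on_C1_at iS zt).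
  exact: C1_at_diff.
have [t /andP[t0 t1]] := MVT_ray df.
have tI : 0 <= t <= 1 by rewrite !ltW.
have [zt [Ft ft]] := rP _ (ball_ray za zb tI).
have h1 : (fcoord c b - fcoord c a) 0 1 = 0.
  by rewrite !mxE; move: hab; rewrite /transverse_coord => ->; rewrite subrr.
have fF q : fdom c q -> f (fcoord c q) = F q by move=> /ci[_]; rewrite /f /= => ->.
have := deriveZv ((fcoord c b - fcoord c a) 0 0) e0 (df t tI).
rewrite -(rowE _ h1) => ->; rewrite !fF// Fab subrr => /esym/eqP.
rewrite scaler_eq0 (negbTE ft) orbF => /eqP h0.
have : fcoord c b - fcoord c a = 0.
  by rewrite (rowE _ h1) h0 scale0r.
move=> /eqP; rewrite subr_eq0 => /eqP zab.
by rewrite -(ci _ ca).2 -(ci _ cb).2 zab.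
Qed.

End Charts.

(** * Trajectories *)

Section RealInduction.
Context {R : realType}.

(** Takes the place of a finite cover of the time interval. A good time just below the supremum of
    the good ones lies in the window at the supremum, and pushes the property beyond it. *)
Lemma real_induction (P : R -> Prop) (a b : R) : a <= b -> P a ->
  (forall t, exists2 h, 0 < h & forall s s', t - h < s -> s <= s' -> s' < t + h ->
    P s -> P s') ->
  P b.
Proof.
move=> ab Pa step; pose A := [set t | a <= t <= b /\ P t].
have Aa : A a by split; rewrite ?lexx.
have As : has_sup A by split; [exists a|exists b => t [/andP[]]].
have [h h0 hP] := step (sup A).
have [s As' s1] := sup_adherent h0 As.
have sA : s <= sup A by apply: ub_le_sup => //; exact: As.2.
case: As' => /andP[as_ sb] Ps.
have [bA|Ab] := ltP b (sup A + h); first exact: hP Ps.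
have Ps' : P (sup A + h / 2) by apply: (hP s) => //; lra.
have : sup A + h / 2 <= sup A.
  apply: ub_le_sup; first exact: As.2.
  by split => //; lra.
lra.
Qed.

Lemma derive0_eq (f : R -> R) (a b : R) : a <= b ->
  (forall t, a <= t <= b -> is_derive t 1 f 0) -> f a = f b.
Proof.
move=> ab df.
have cf t : a <= t <= b -> {for t, continuous f}.
  by move=> /df[dft _]; apply/differentiable_continuous/derivable1_diffP.
have df' t : a < t < b -> is_derive t 1 f 0.
  by move=> /andP[at_ tb]; apply: df; rewrite !ltW.
apply/eqP; rewrite eq_le; apply/andP; split; last first.
  exact: (@derive_le0_nonincreasing _ f (fun=> 0) a b).
rewrite -lerN2; apply: (@derive_le0_nonincreasing _ (fun t => - f t) (fun=> 0) a b ab) => //.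
  by move=> t /cf; exact: cvgN.
by move=> t /df' dft; apply: is_derive_eq; rewrite oppr0.
Qed.

End RealInduction.

Section Trajectories.
Context {R : realType}.
Local Notation plane := 'rV[R]_2.
Implicit Types (M : set plane) (X : plane -> plane) (x y : R -> plane).

Definition trajectory M X x : Prop :=
  forall t : R, M (x t) /\ is_derive t 1 x (X (x t)).

Lemma trajectory_continuous M X x : trajectory M X x -> continuous x.
Proof. by move=> xM t; have [_ [dx _]] := xM t; apply/differentiable_continuous/derivable1_diffP. Qed.

Lemma trajectory_opp M X x : trajectory M X x ->
  trajectory M (fun p => - X p) (fun t => x (- t)).
Proof.
move=> xM t; split; first by have [] := xM (- t).
have [_ dx] := xM (- t).
have [dxt E] := dx.
have dN : is_derive t 1 (-%R : R -> R) (- 1) by exact: is_deriveNid.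
have dx' : differentiable x (- t) by exact/derivable1_diffP.
have := is_derive_curve dx' dN.
by rewrite (deriveNv _ dx') E.
Qed.

(** In place of Gronwall's inequality: as long as the orbits are within [2 * c] of each other, both
    run in a ball where [X] is Lipschitz, so their difference moves by at most [c / 2] and stays
    below [3 * c / 2]. The same [h] and [e] serve all trajectories [x] and all starting times in the
    window. *)
Lemma local_dependence M X y t0 N : trajectory M X y -> C1_at X (y t0) -> nbhs (y t0) N ->
  exists h e : R, [/\ 0 < h, 0 < e &
    forall x t1 t2 c, trajectory M X x -> t0 - h < t1 -> t1 <= t2 -> t2 < t0 + h ->
      `|x t1 - y t1| < c -> c <= e ->
      forall s, t1 <= s <= t2 -> N (x s) /\ `|x s - y s| < 2 * c].
Proof.
move=> yM [dX cX] /nbhs_ballP[r2 /= r20 rN].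
have [L [r1 [L0 r10 LP]]] := locally_lipschitz dX cX.
pose r := Num.min r1 r2.
have r0 : 0 < r by rewrite lt_min r10 r20.
have rr1 : r <= r1 by rewrite ge_min lexx.
have rr2 : r <= r2 by rewrite ge_min lexx orbT.
have /nbhs_ballP[h1 /= h10 hP] : \forall s \near t0, ball (y t0) (r / 2) (y s).
  by apply: (trajectory_continuous yM); apply: nbhsx_ballx; rewrite divr_gt0.
(* Both times lie in a window of length [2 * h]; this choice bounds the drift
   [L * (2 * c) * (2 * h)] by [c / 2]. *)
pose h := Num.min h1 (8 * L)^-1.
have h0 : 0 < h by rewrite lt_min h10 invr_gt0 mulr_gt0.
have hh1 : h <= h1 by rewrite ge_min lexx.
have hL : L * h <= 8^-1.
  have : h <= (8 * L)^-1 by rewrite ge_min lexx orbT.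
  by rewrite -(ler_pM2l L0) invfM mulrCA mulfV ?mulr1// gt_eqF.
(* With [c <= r / 8], a point within [2 * c] of [y s] is within [r / 2 + r / 4] of [y t0], hence in
   the Lipschitz ball and in [N]. *)
exists h, (r / 8); split => //; first by rewrite divr_gt0.
move=> x t1 t2 c xM ht1 t12 ht2 xyc cr.
have c0 : 0 < c by exact: le_lt_trans xyc.
have yball s : t1 <= s <= t2 -> `|y t0 - y s| < r / 2.
  move=> /andP[s1 s2]; have := hP s; rewrite -!ball_normE /ball_/=; apply.
  by rewrite ltr_norml; apply/andP; split; lra.
have xball s : t1 <= s <= t2 -> `|x s - y s| < 2 * c -> `|y t0 - x s| < r.
  move=> s12 xys; have := yball s s12.
  have : `|y t0 - x s| <= `|y t0 - y s| + `|x s - y s|.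
    by rewrite (distrC (x s)) ler_distD.
  lra.
have wd (t : R) : is_derive t 1 (fun s => x s - y s) (X (x t) - X (y t)).
  by have [_ dx] := xM t; have [_ dy] := yM t; exact: is_deriveB.
have main : forall t, t1 <= t <= t2 -> `|x t - y t| < 2 * c.
  apply: continuous_stay_below.
    move=> t _; apply: cvg_norm; apply: cvgB; exact: trajectory_continuous.
  move=> t /andP[tt1 tt2] below.
  have : `|(x t - y t) - (x t1 - y t1)| <= c / 2.
    apply: row_norm_le; first by rewrite divr_ge0// ltW.
    move=> i; have [<-|t1t] := eqVneq t1 t.
      by rewrite subrr mxE normr0 divr_ge0// ltW.
    have t1t' : t1 < t by rewrite lt_neqAle t1t.
    pose w (s : R) := (x s - y s) 0 i.
    have dwi (s : R) : is_derive s 1 w ((X (x s) - X (y s)) 0 i).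
      exact: is_derive_coord (wd s).
    have cw : {within `[t1, t], continuous w}.
      apply: continuous_in_subspaceT => s _.
      by apply/differentiable_continuous/derivable1_diffP; have [] := dwi s.
    have [s sI] := MVT t1t' (fun s _ => dwi s) cw.
    have -> : ((x t - y t) - (x t1 - y t1)) 0 i = w t - w t1 by rewrite /w !mxE.
    move=> ->; rewrite normrM.
    have st : t1 <= s < t by move: sI; rewrite in_itv /= => /andP[/ltW-> ->].
    have s12 : t1 <= s <= t2 by case/andP: st => -> /ltW/le_trans->.
    have fs := below _ st.
    have Xs : `|X (x s) - X (y s)| <= L * `|x s - y s|.
      apply: LP; rewrite -ball_normE /ball_/=.
        exact: lt_le_trans (xball _ s12 fs) rr1.
      by apply: lt_le_trans (yball _ s12) _; lra.
    have Xi := coord_norm_le (X (x s) - X (y s)) i.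
    have tt : `|t - t1| <= 2 * h by rewrite ger0_norm; lra.
    have : `|(X (x s) - X (y s)) 0 i| <= L * (2 * c).
      by apply: le_trans Xi (le_trans Xs _); rewrite ler_pM2l// ltW.
    move=> Xi'; have := ler_pM (normr_ge0 _) (normr_ge0 _) Xi' tt.
    move/le_trans; apply.
    have -> : L * (2 * c) * (2 * h) = 4 * c * (L * h) by ring.
    have : 4 * c * (L * h) <= 4 * c * 8^-1 by rewrite ler_pM2l// mulr_gt0.
    lra.
  have := ler_normD (x t1 - y t1) ((x t - y t) - (x t1 - y t1)).
  rewrite subrKC; lra.
move=> s s12; split; last exact: main.
by apply: rN; rewrite -ball_normE /ball_/=; exact: lt_le_trans (xball _ s12 (main _ s12)) rr2.
Qed.

End Trajectories.

Section FoliationAtlas.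
Context {R : realType} (M : set 'rV[R]_2) (A : set (@fol_chart R)).
Hypothesis A_fol : is_foliation M A.

Lemma foliation_chart c : A c -> is_fol_chart M c.
Proof. by case: A_fol => + _ _; exact. Qed.

Lemma foliation_cover p : M p -> exists2 c, A c & fdom c p.
Proof. by case: A_fol => _ + _; exact. Qed.

Lemma nbhs_fdom c p : A c -> fdom c p -> nbhs p (fdom c).
Proof. by move=> /foliation_chart[[oc _] _ _ _ _] cp; exact: open_nbhs_nbhs. Qed.

End FoliationAtlas.

(** * Holonomy: labels of leaves carried along trajectories *)

Section Holonomy.
Context {R : realType}.
Local Notation plane := 'rV[R]_2.
Variables (M : set plane) (X : plane -> plane) (A : set (@fol_chart R)).
Hypothesis X_C1 : forall p, M p -> C1_at X p.
Hypothesis A_fol : is_foliation M A.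
Hypothesis A_X : forall p, M p -> leaf_tangent A p (X p).

Lemma transverse_coord_trajectory c x (a b : R) : A c -> trajectory M X x -> a <= b ->
  (forall s, a <= s <= b -> fdom c (x s)) ->
  transverse_coord c (x a) = transverse_coord c (x b).
Proof.
move=> c_ xM ab xc; have cC := foliation_chart A_fol c_.
apply: (@derive0_eq _ (transverse_coord c \o x) a b ab) => t tI.
have [Mx dx] := xM t.
have dh := C1_at_diff (nbhs_singleton (transverse_coord_C1 cC (xc _ tI))).
by have := is_derive_curve dh dx; rewrite (A_X Mx c_)//; exact: xc.
Qed.

Variables (I : Type) (F : set_system I).
Context {FF : Filter F}.
Variables (D : set I) (x : I -> R -> plane) (y : R -> plane).
Hypothesis FD : F D.
Hypothesis xM : forall i, D i -> trajectory M X (x i).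
Hypothesis yM : trajectory M X y.

Definition label_inj (c : fol_chart) (t : R) : Prop :=
  exists2 B, F B & forall i j, B i -> B j ->
    transverse_coord c (x i t) = transverse_coord c (x j t) -> i = j.

(** Asking for all charts at [y t] lets the continuation along the orbit change chart freely; by
    [separated_chart] a single one suffices. *)
Definition separated (t : R) : Prop :=
  x i t @[i --> F] --> y t /\ forall c, A c -> fdom c (y t) -> label_inj c t.

Lemma separated_chart c t : A c -> fdom c (y t) -> x i t @[i --> F] --> y t ->
  label_inj c t -> separated t.
Proof.
move=> c_ cy xy [B FB Bi]; split => // c' c'_ c'y.
have [N yN NP] := chart_change A_fol c'_ c_ c'y cy.
exists (B `&` [set i | N (x i t)]); first by apply: filterI => //; exact: xy.
by move=> i j [Bii Ni] [Bj Nj] h; apply: Bi => //; exact: NP.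
Qed.

(** In a short window the orbits near [y] stay in one chart, where the transverse coordinate is
    constant along each of them; labels at [s'] are therefore labels at [s]. *)
Lemma separated_near t0 : exists2 h, 0 < h & forall s s', t0 - h < s -> s <= s' ->
  s' < t0 + h -> separated s -> separated s'.
Proof.
have [My _] := yM t0; have [c c_ cy] := foliation_cover A_fol My.
have [h [e [h0 e0 dep]]] := local_dependence yM (X_C1 My) (nbhs_fdom A_fol c_ cy).
exists h => // s s' hs ss' s'h [xys lab].
have sI : s <= s <= s' by rewrite lexx.
have s'I : s <= s' <= s' by rewrite ss' lexx.
have yin r : s <= r <= s' -> fdom c (y r).
  (* [y] is compared with itself, so that [dep] yields just its stay in the domain of [c]. *)
  by move=> rI; have [] := dep y s s' e yM hs ss' s'h _ (lexx e) r rI; rewrite ?subrr ?normr0.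
have [B FB Binj] := lab c c_ (yin _ sI).
have near_s d : 0 < d -> F (D `&` [set i | `|x i s - y s| < d]).
  move=> d0; move/cvgrPdist_lt : xys => /(_ _ d0) xyd.
  by apply: filterI => //; apply: filterS xyd => i; rewrite /= distrC.
apply: (separated_chart c_ (yin _ s'I)).
  apply/cvgrPdist_lt => d d0; pose c0 := Num.min e (d / 2).
  have c00 : 0 < c0 by rewrite lt_min e0 divr_gt0.
  have c0e : c0 <= e by rewrite ge_min lexx.
  have c0d : c0 <= d / 2 by rewrite ge_min lexx orbT.
  apply: filterS (near_s _ c00) => i [Di xis].
  have [_] := dep (x i) s s' c0 (xM Di) hs ss' s'h xis c0e s' s'I.
  by rewrite distrC; lra.
exists (B `&` (D `&` [set i | `|x i s - y s| < e])); first by apply: filterI => //; exact: near_s.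
move=> i j [Bi [Di xi]] [Bj [Dj xj]] hij; apply: Binj => //.
have xin k r : D k -> `|x k s - y s| < e -> s <= r <= s' -> fdom c (x k r).
  by move=> Dk xk rI; have [] := dep (x k) s s' e (xM Dk) hs ss' s'h xk (lexx e) r rI.
have -> := transverse_coord_trajectory c_ (xM Di) ss' (fun r => xin i r Di xi).
by have -> := transverse_coord_trajectory c_ (xM Dj) ss' (fun r => xin j r Dj xj).
Qed.

Lemma separated_forward t : 0 <= t -> separated 0 -> separated t.
Proof. by move=> t0 s0; apply: (real_induction t0 s0) => s; exact: separated_near. Qed.

End Holonomy.

(** * Stability of attracting critical points *)

Section Stability.
Context {R : realType}.
Local Notation plane := 'rV[R]_2.

Lemma is_derive_expR_affine (k T s : R) :
  is_derive s 1 (fun s => expR (k * (s - T))) (k * expR (k * (s - T))).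
Proof.
have d0 : is_derive s 1 (fun s : R => s - T) 1.
  by have := is_deriveB (is_derive_id s 1) (is_derive_cst T s 1); rewrite subr0.
have d1 : is_derive s 1 (fun s : R => k * (s - T)) k.
  by have := is_deriveZ k d0; rewrite [k *: _]mulr1.
have := @is_derive1_comp _ expR (fun s => k * (s - T)) s _ _ (is_derive_expR (k * (s - T))) d1.
by rewrite mulrC.
Qed.

Variables (M : set plane) (X : plane -> plane) (F : plane -> R) (Z : plane -> plane)
  (p : plane).
Hypothesis X_FZ : \forall q \near p, X q = F q *: Z q.
Hypothesis F_C1 : C1_at F p.
Hypothesis Z_cont : {for p, continuous Z}.
Hypothesis Fp : F p = 0.
Hypothesis DZF : 'D_(Z p) F p < 0.

(* Along an orbit near [p], [F] decays exponentially while the speed is at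
   most [C * |F|], so the orbit has length at most [C / k * |F|]. *)
Lemma attracting_stable (rho : R) : 0 < rho -> exists2 d : R, 0 < d &
  forall x T, trajectory M X x -> `|x T - p| < d ->
    forall t, T <= t -> `|x t - p| < rho.
Proof.
move=> rho0; pose D : R := 'D_(Z p) F p; have D0 : D < 0 by exact: DZF.
(* [k] is half the decay rate at [p], which leaves a margin for continuity on a neighbourhood; the
   [1] in [C] is the same margin for the norm of [Z]. *)
pose k : R := - D / 2; pose C : R := `|Z p| + 1.
have k0 : 0 < k by rewrite /k; lra.
have C0 : 0 < C by rewrite ltr_wpDl.
have n1 : nbhs p [set q | 'D_(Z q) F q <= - k].
  have : 'D_(Z q) F q @[q --> p] --> 'D_(Z p) F p.
    exact: (@cvg_derive_C1 _ _ _ _ _ (nbhs p) _ id Z _ _ F_C1 cvg_id Z_cont).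
  move/cvgr_le; apply; rewrite -/D /k; lra.
have n2 : nbhs p [set q | `|Z q| <= C].
  by have := @cvgr_norm_le _ _ _ _ _ _ _ Z_cont; apply; rewrite ltrDl.
have /nbhs_ballP[r1 /= r10 rP] := nbhsI X_FZ (nbhsI F_C1.1 (nbhsI n1 n2)).
pose r := Num.min r1 rho.
have r0 : 0 < r by rewrite lt_min r10 rho0.
have rr1 : r <= r1 by rewrite ge_min lexx.
have rrho : r <= rho by rewrite ge_min lexx orbT.
(* Starting with [|F|] below this bound limits the displacement to [r / 4]; added to an initial
   distance below [r / 4], it keeps the orbit within [r / 2] of [p]. *)
have b0 : 0 < k / C * (r / 4) by rewrite mulr_gt0// divr_gt0.
have n3 : nbhs p [set q | `|F q| < k / C * (r / 4)].
  apply: (@C1_at_nbhs _ _ _ _ _ [set y : R | `|y| < k / C * (r / 4)] F_C1).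
  by rewrite Fp; apply/nbhs_ballP; exists (k / C * (r / 4)) => //= z; rewrite -ball_normE /ball_/= sub0r normrN.
have /nbhs_ballP[r2 /= r20 r2P] := n3.
exists (Num.min r2 (r / 4)); first by rewrite lt_min r20 divr_gt0.
move=> x T xM; rewrite lt_min => /andP[xT2 xT4] t Tt.
have xd (s : R) : is_derive s 1 x (X (x s)) by have [] := xM s.
have xc := trajectory_continuous xM.
pose m : R := `|F (x T)|.
have mb : C * m / k < r / 4.
  have : m < k / C * (r / 4) by apply: r2P; rewrite -ball_normE /ball_/= distrC.
  rewrite -(ltr_pM2l (divr_gt0 C0 k0)) mulrA mulf_div (mulrC C k) divff; last first.
    by rewrite mulf_neq0// gt_eqF.
  by rewrite mul1r mulrAC.
suff : forall t' : R, T <= t' <= t -> `|x t' - p| < r.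
  by move=> /(_ t); rewrite Tt lexx => /(_ isT) /lt_le_trans; apply.
apply: continuous_stay_below => [s _|{}t' /andP[Tt' _] below].
  by apply: cvg_norm; apply: cvgB; [exact: xc|exact: cvg_cst].
have [<-|Tneq] := eqVneq T t'; first by apply: lt_le_trans xT4 _; lra.
have TT' : T < t' by rewrite lt_neqAle Tneq.
(* [below] speaks of times before [t'], so the estimate is made at [s < t'] and passed to the limit;
   the bound [r / 2] keeps the conclusion strict. *)
suff half (s : R) : T <= s < t' -> `|x s - p| <= r / 2.
  have : `|x t' - p| <= r / 2.
    have c1 : `|x s - p| @[s --> t'^'-] --> `|x t' - p|.
      by apply: cvg_at_left_filter; apply: cvg_norm; apply: cvgB; [exact: xc|exact: cvg_cst].
    apply: (cvgr_to_le c1); near=> s; apply: half; apply/andP; split.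
      by apply/ltW; near: s; exact: nbhs_left_gt.
    by near: s; exact: nbhs_left_lt.
  lra.
move=> /andP[Ts st'].
have good (u : R) : T <= u <= s -> [/\ X (x u) = F (x u) *: Z (x u), differentiable F (x u),
    'D_(Z (x u)) F (x u) <= - k & `|Z (x u)| <= C].
  move=> /andP[Tu us]; have xu : ball p r1 (x u).
    rewrite -ball_normE /ball_/= distrC; apply: lt_le_trans rr1; apply: below.
    by rewrite Tu (le_lt_trans us).
  by have [? [? [? ?]]] := rP _ xu; split.
pose g (u : R) := F (x u) * expR (k * (u - T)).
have gd (u : R) : T <= u <= s -> is_derive u 1 g (('D_(Z (x u)) F (x u) + k) * g u).
  move=> /good[XE dF _ _].
  have d1 := is_derive_curve dF (xd u).
  have d2 := is_derive_expR_affine k T u.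
  rewrite (_ : _ * g u = (F \o x) u *: (k * expR (k * (u - T))) +
      expR (k * (u - T)) *: 'D_(X (x u)) F (x u)); first exact: is_deriveM d1 d2.
  by rewrite XE deriveZv// /g /GRing.scale /=; ring.
have decay (u : R) : T <= u <= s -> `|F (x u)| <= m * expR (- k * (u - T)).
  move=> /andP[Tu us].
  (* Squaring treats both signs of [F] at once: the derivative of [g ^+ 2] is [2 * ('D_(Z (x v)) F
     (x v) + k) * g v ^+ 2], which is nonpositive. *)
  have gE : g u ^+ 2 <= g T ^+ 2.
    apply: (@derive_le0_nonincreasing _ (fun v => g v ^+ 2)
      (fun v => 2 * ('D_(Z (x v)) F (x v) + k) * g v ^+ 2) T u Tu).
    - move=> v /andP[Tv vu]; have vI : T <= v <= s by rewrite Tv (le_trans vu).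
      have [dg _] := gd v vI.
      have gc : {for v, continuous g} by apply/differentiable_continuous/derivable1_diffP.
      exact: (cvgM gc gc).
    - move=> v /andP[Tv vu]; have vI : T <= v <= s by rewrite !ltW// (lt_le_trans vu).
      rewrite (_ : _ * g v ^+ 2 = g v *: (('D_(Z (x v)) F (x v) + k) * g v) +
          g v *: (('D_(Z (x v)) F (x v) + k) * g v)); first exact: is_deriveM (gd v vI) (gd v vI).
      by rewrite /GRing.scale /=; ring.
    - move=> v /andP[Tv vu]; have vI : T <= v <= s by rewrite !ltW// (lt_le_trans vu).
      have [_ _ Dk _] := good v vI.
      by rewrite mulr_le0_ge0 ?sqr_ge0//; lra.
  have gT : g T = F (x T) by rewrite /g subrr mulr0 expR0 mulr1.
  have : `|g u| <= m.
    by rewrite /m -gT -!sqrtr_sqr ler_wsqrtr.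
  rewrite /g normrM (ger0_norm (expR_ge0 _)) => gm.
  have := ler_wpM2r (expR_ge0 (- k * (u - T))) gm.
  by rewrite -mulrA -expRD mulNr subrr expR0 mulr1.
(* The exponential term of [phi] bounds the displacement still to come: its derivative is minus the
   bound on the speed, so [phi] decreases. The values [1] and [-1] of [sg] give the two halves of an
   absolute value. *)
have coord_bound i (sg : R) : `|sg| = 1 -> sg * (x s 0 i - x T 0 i) <= r / 4.
  move=> sg1; pose phi (u : R) := sg * x u 0 i + C * m / k * expR (- k * (u - T)).
  have : phi s <= phi T.
    apply: (@derive_le0_nonincreasing _ phi
      (fun u => sg * X (x u) 0 i + C * m / k * (- k * expR (- k * (u - T)))) T s Ts).
    - move=> u _; have dxi := is_derive_coord 0 i (xd u).
      have [dxi' _] := dxi.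
      have cxi : {for u, continuous (fun v => x v 0 i)} by apply/differentiable_continuous/derivable1_diffP.
      have [de _] := is_derive_expR_affine (- k) T u.
      have ce : {for u, continuous (fun v => expR (- k * (v - T)))} by apply/differentiable_continuous/derivable1_diffP.
      by apply: cvgD; apply: cvgM => //; exact: cvg_cst.
    - move=> u _; have dxi := is_derive_coord 0 i (xd u).
      have de := is_derive_expR_affine (- k) T u.
      by have := is_deriveD (is_deriveZ sg dxi) (is_deriveZ (C * m / k) de); exact.
    - move=> u /andP[Tu us]; have uI : T <= u <= s by rewrite !ltW.
      have [XE _ _ ZC] := good u uI; have Fm := decay u uI.
      have : sg * X (x u) 0 i <= C * (m * expR (- k * (u - T))).
        apply: le_trans (ler_norm _) _; rewrite normrM sg1 mul1r XE mxE normrM mulrC.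
        apply: ler_pM => //; exact: le_trans (coord_norm_le _ _) ZC.
      have -> : C * m / k * (- k * expR (- k * (u - T))) = - (C * (m * expR (- k * (u - T)))).
        by field; rewrite gt_eqF.
      lra.
  rewrite /phi subrr mulr0 expR0 mulr1.
  have : 0 <= C * m / k * expR (- k * (s - T)).
    apply: mulr_ge0; last exact: expR_ge0.
    by apply: divr_ge0; [apply: mulr_ge0; [exact: ltW|exact: normr_ge0]|exact: ltW].
  move: (_ * expR _) mb => e mb e0 le_e; rewrite mulrBr; lra.
have : `|x s - x T| <= r / 4.
  apply: row_norm_le => [|i]; first by rewrite divr_ge0// ltW.
  rewrite !mxE ler_norml; apply/andP; split.
    have := coord_bound i (- 1); rewrite normrN1 => /(_ erefl); lra.
  have := coord_bound i 1; rewrite normr1 => /(_ erefl); lra.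
have := ler_distD (x T) (x s) p; lra.
Unshelve. all: by end_near. Qed.

End Stability.

(** * Limit points of a family of trajectories *)

Section EndMap.
Context {R : realType}.
Local Notation plane := 'rV[R]_2.
Variables (M : set plane) (X : plane -> plane) (A : set (@fol_chart R)).
Hypothesis X_C1 : forall p, M p -> C1_at X p.
Hypothesis A_fol : is_foliation M A.
Hypothesis A_X : forall p, M p -> leaf_tangent A p (X p).
Variables (I : Type) (F : set_system I).
Context {FF : Filter F}.
Variables (D : set I) (x : I -> R -> plane) (y : R -> plane).
Hypothesis FD : F D.
Hypothesis xM : forall i, D i -> trajectory M X (x i).
Hypothesis yM : trajectory M X y.
Hypothesis sep0 : separated A F x y 0.
Variables (om : I -> plane) (p : plane).
Hypothesis x_om : forall i, D i -> x i t @[t --> +oo] --> om i.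
Hypothesis y_p : y t @[t --> +oo] --> p.
Hypothesis Mp : M p.
Variables (G : plane -> R) (Z : plane -> plane).
Hypothesis X_GZ : \forall q \near p, X q = G q *: Z q.
Hypothesis G_C1 : \forall q \near p, C1_at G q.
Hypothesis Z_cont : {for p, continuous Z}.
Hypothesis Gp : G p = 0.
Hypothesis DZG : 'D_(Z p) G p < 0.

(** [T] is a time at which [y] is already in the stability ball of [p]. Dependence over the bounded
    time [T] brings the nearby members into this ball too, and all are trapped from the common time
    [T] on. *)
Let eventually_near (rho : R) : 0 < rho -> exists T : R, [/\ 0 <= T,
  forall t, T <= t -> `|y t - p| < rho &
  F [set i | D i /\ forall t, T <= t -> `|x i t - p| < rho]].
Proof.
move=> rho0.
have [d d0 dP] := attracting_stable M X_GZ (nbhs_singleton G_C1) Z_cont Gp DZG rho0.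
have nT : \forall t \near +oo, `|y t - p| < d.
  by move/cvgrPdist_lt : y_p => /(_ _ d0); apply: filterS => t; rewrite distrC.
have [T T0 yT] := pinfty_ex_gt0 nT.
exists T; split; first exact: ltW.
  by move=> t Tt; exact: dP Tt.
have [xT _] := separated_forward X_C1 A_fol A_X FD xM yM (ltW T0) sep0.
have d'0 : 0 < d - `|y T - p| by rewrite subr_gt0.
move/cvgrPdist_lt : xT => /(_ _ d'0) /(filterI FD); apply: filterS => i [Di xiT].
split => // t Tt; apply: (dP (x i) T) => //; first exact: xM.
have := ler_distD (y T) (x i T) p; rewrite (distrC (x i T) (y T)); lra.
Qed.

Let limit_near (rho : R) (z : R -> plane) (q : plane) (T : R) :
  (forall t, T <= t -> `|z t - p| < rho) -> z t @[t --> +oo] --> q -> `|q - p| <= rho.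
Proof.
move=> zp zq; have cz : `|z t - p| @[t --> +oo] --> `|q - p|.
  by apply: cvg_norm; apply: cvgB => //; exact: cvg_cst.
apply: (cvgr_to_le cz); near=> t; apply/ltW/zp.
by near: t; apply: nbhs_pinfty_ge; exact: num_real.
Unshelve. all: by end_near. Qed.

Lemma end_cvg : om i @[i --> F] --> p.
Proof.
apply/cvgrPdist_lt => e e0; have e2 : 0 < e / 2 by rewrite divr_gt0.
have [T [_ _]] := eventually_near e2; apply: filterS => i [Di xi].
by have := limit_near xi (x_om Di); rewrite distrC; lra.
Qed.

(** After [T] the orbits stay in one chart around [p], where the label is constant in time and, by
    continuity, passes to the limit point; labels at infinity are thus labels at time [T]. *)
Lemma end_label_inj c : A c -> fdom c p -> exists2 B, F B & forall i j, B i -> B j ->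
  transverse_coord c (om i) = transverse_coord c (om j) -> i = j.
Proof.
move=> c_ cp; have cC := foliation_chart A_fol c_.
have /nbhs_ballP[r /= r0 rP] := nbhs_fdom A_fol c_ cp.
have r2 : 0 < r / 2 by rewrite divr_gt0.
have [T [T0 yT xT]] := eventually_near r2.
have inc q : `|q - p| <= r / 2 -> fdom c q.
  by move=> qp; apply: rP; rewrite -ball_normE /ball_/= distrC; lra.
have [_ lab] := separated_forward X_C1 A_fol A_X FD xM yM T0 sep0.
have [B FB Binj] := lab c c_ (inc _ (ltW (yT T (lexx T)))).
exists (B `&` [set i | D i /\ forall t, T <= t -> `|x i t - p| < r / 2]); first exact: filterI.
have labE i : D i -> (forall t, T <= t -> `|x i t - p| < r / 2) ->
    transverse_coord c (om i) = transverse_coord c (x i T).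
  move=> Di xi; have omi := inc _ (limit_near xi (x_om Di)).
  have hc := C1_at_continuous (nbhs_singleton (transverse_coord_C1 cC omi)).
  have h1 : transverse_coord c (x i t) @[t --> +oo] --> transverse_coord c (om i).
    exact: (@cvg_comp _ _ _ (x i) (transverse_coord c) _ _ _ (x_om Di) hc).
  apply: (cvg_unique (@norm_hausdorff _ R) h1).
  apply: cvg_near_cst; near=> t; have Tt : T <= t by near: t; apply: nbhs_pinfty_ge; exact: num_real.
  apply/esym; apply: (transverse_coord_trajectory A_fol A_X c_ (xM Di) Tt) => s /andP[Ts _].
  exact/inc/ltW/xi.
move=> i j [Bi [Di xi]] [Bj [Dj xj]]; rewrite !labE//; exact: Binj.
Unshelve. all: by end_near. Qed.

Variables (gam : R -> plane) (u : I -> R) (a b u0 : R).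
Hypothesis gam_cont : {in `]a, b[, continuous gam}.
Hypothesis gam_inj : {in `]a, b[ &, injective gam}.
Hypothesis gam_X : forall v, v \in `]a, b[ -> X (gam v) = 0.
Hypothesis Z_neq0 : \forall q \near p, Z q != 0.
Hypothesis Z_leaf : leaf_tangent A p (Z p).
Hypothesis gam_u : forall i, D i -> (u i \in `]a, b[) /\ gam (u i) = om i.
Hypothesis u0I : u0 \in `]a, b[.
Hypothesis gam_u0 : gam u0 = p.

(* Near [p] the curve [gam] is a graph over the transverse coordinate. *)
Lemma end_param_cvg : u i @[i --> F] --> u0.
Proof.
have [c c_ cp] := foliation_cover A_fol Mp.
have cC := foliation_chart A_fol c_.
have DZG0 : 'D_(Z p) G p != 0 by rewrite lt_eqF.
have [N pN Ninj] := plaque_injective A_fol c_ cp G_C1 Z_leaf DZG0.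
have hC := nbhs_singleton (transverse_coord_C1 cC cp).
(* On [W] the points of the curve are zeros of [G], because [X = G *: Z] with [Z] nonzero; [Ninj]
   then allows at most one of them per plaque. *)
pose W := N `&` (fdom c `&` ([set q | X q = G q *: Z q] `&` [set q | Z q != 0])).
have pW : nbhs p W by apply: nbhsI pN (nbhsI _ (nbhsI X_GZ Z_neq0)); exact: nbhs_fdom A_fol _ _ c_ cp.
have G0 v : v \in `]a, b[ -> W (gam v) -> G (gam v) = 0.
  move=> vI [_ [_ [/= + Zv]]]; rewrite gam_X// => /esym/eqP.
  by rewrite scaler_eq0 (negbTE Zv) orbF => /eqP.
have gc : {for u0, continuous gam} := gam_cont u0I.
have nW : \forall v \near u0, W (gam v) by apply: gc; rewrite gam_u0.
apply/cvgrPdist_lt => e e0.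
have nI : \forall v \near u0, v \in `]a, b[ by exact: near_in_itvoo.
have /nbhs_ballP[r /= r0 rP] := nbhsI nW nI.
pose d := Num.min (r / 2) (e / 2).
have d0 : 0 < d by rewrite lt_min !divr_gt0.
have dr : d <= r / 2 by rewrite ge_min lexx.
have de : d <= e / 2 by rewrite ge_min lexx orbT.
have good v : v \in `[u0 - d, u0 + d] -> W (gam v) /\ (v \in `]a, b[).
  rewrite in_itv /= => /andP[v1 v2]; apply: rP.
  by rewrite -ball_normE /ball_/= ltr_norml; apply/andP; split; lra.
pose th v := transverse_coord c (gam v).
have thc : {within `[u0 - d, u0 + d], continuous th}.
  apply: continuous_in_subspaceT => v; rewrite inE /= => vI.
  have [[_ [cv _]] vab] := good v vI.
  have hv := C1_at_continuous (nbhs_singleton (transverse_coord_C1 cC cv)).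
  exact: (@cvg_comp _ _ _ gam (transverse_coord c) _ _ _ (gam_cont vab) hv).
have thi : {in `[u0 - d, u0 + d] &, injective th}.
  move=> v w vI wI thvw; have [Wv vab] := good v vI; have [Ww wab] := good w wI.
  apply: gam_inj => //; apply: Ninj; [exact: Wv.1|exact: Ww.1|exact: thvw|].
  by rewrite !G0.
have u0d : u0 \in `[u0 - d, u0 + d] by rewrite in_itv /=; apply/andP; split; lra.
have lI : u0 - d \in `[u0 - d, u0 + d] by rewrite in_itv /=; apply/andP; split; lra.
have rI : u0 + d \in `[u0 - d, u0 + d] by rewrite in_itv /=; apply/andP; split; lra.
have l0 : u0 - d < u0 by lra.
have r0' : u0 < u0 + d by lra.
(* [th] is strictly monotone, so a limit point close to [p] has its label between those of the two
   ends. The intermediate value theorem then gives a parameter in the segment on the same plaque,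
   and it has to be [u i]. *)
have thE : Num.min (th (u0 - d)) (th (u0 + d)) < th u0 < Num.max (th (u0 - d)) (th (u0 + d)).
  have [mon|mon] := itv_continuous_inj_mono thc thi.
    have h1 := mon _ _ lI u0d l0.
    have h2 := mon _ _ u0d rI r0'.
    by rewrite min_l ?max_r ?h1// ltW// (lt_trans h1).
  have h1 := mon _ _ u0d lI l0.
  have h2 := mon _ _ rI u0d r0'.
  by rewrite min_r ?max_l ?h1 ?h2// ltW// (lt_trans h2).
have hp : {for p, continuous (transverse_coord c)} := C1_at_continuous hC.
have nh : F [set i | Num.min (th (u0 - d)) (th (u0 + d)) <
    transverse_coord c (om i) < Num.max (th (u0 - d)) (th (u0 + d))].
  have c1 : transverse_coord c (om i) @[i --> F] --> th u0.
    by rewrite /th gam_u0; exact: (@cvg_comp _ _ _ om (transverse_coord c) _ _ _ end_cvg hp).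
  case/andP: thE => th1 th2.
  have n1 := @cvgr_gt _ _ _ FF _ _ c1 _ th1; have n2 := @cvgr_lt _ _ _ FF _ _ c1 _ th2.
  by apply: filterS2 n1 n2 => i h1 h2; exact/andP.
have nom : F [set i | W (om i)] by exact: end_cvg pW.
apply: filterS (filterI FD (filterI nh nom)) => i [Di [/andP[h1 h2] Wi]].
have h12 : Num.min (th (u0 - d)) (th (u0 + d)) <= transverse_coord c (om i) <=
    Num.max (th (u0 - d)) (th (u0 + d)) by rewrite !ltW.
have lr : u0 - d <= u0 + d by lra.
have [v vI thv] := IVT lr thc h12.
have [Wv vab] := good v vI; have [uI gu] := gam_u Di.
have : gam v = gam (u i).
  apply: Ninj; [exact: Wv.1|by rewrite gu; exact: Wi.1|by rewrite gu|].
  by rewrite !G0// gu.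
move=> /(gam_inj vab uI) <-; move: vI; rewrite in_itv /= => /andP[v1 v2].
by rewrite ltr_norml; apply/andP; split; lra.
Qed.

Lemma end_param_inj : exists2 B, F B & forall i j, B i -> B j -> u i = u j -> i = j.
Proof.
have [c c_ cp] := foliation_cover A_fol Mp.
have [B FB Binj] := end_label_inj c_ cp.
exists (B `&` D); first exact: filterI.
move=> i j [Bi Di] [Bj Dj] uij; apply: Binj => //.
by have [_ <-] := gam_u Di; have [_ <-] := gam_u Dj; rewrite uij.
Qed.

End EndMap.

(** * Continuous locally injective functions on an interval *)

Section LocallyInjective.
Context {R : realType}.

(** Such a function is strictly monotone around every interior point, hence has no interior
    extremum. If [u a = u b], the maximum and the minimum over the segment are both attained at the
    ends, so [u] is constant there and the midpoint is an extremum. *)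
Lemma locally_injective_injective (s0 : R) (u : R -> R) :
  (forall s, 0 < s <= s0 -> u r @[r --> within (`]0, s0] : set R) (nbhs s)] --> u s) ->
  (forall s, 0 < s <= s0 -> exists2 B, within (`]0, s0] : set R) (nbhs s) B &
    forall r r', B r -> B r' -> u r = u r' -> r = r') ->
  {in `]0, s0] &, injective u}.
Proof.
move=> uc ui.
have ucont : {within `]0, s0], continuous u}.
  by apply/subspace_continuousP => s /=; rewrite in_itv /= => sI; exact: uc.
have ucont' a b : 0 < a -> b <= s0 -> {within `[a, b], continuous u}.
  move=> a0 bs; apply: continuous_subspaceW ucont => s /=; rewrite !in_itv /= => /andP[as_ sb].
  by rewrite (lt_le_trans a0 as_) (le_trans sb).
have mono c : 0 < c < s0 -> exists2 h : R, 0 < h & forall d : R, 0 < d < h ->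
    (u (c - d) < u c < u (c + d)) || (u (c + d) < u c < u (c - d)).
  move=> /andP[c0 cs]; have [|B] := ui c; first by rewrite c0 ltW.
  move=> /nbhs_ballP[e /= e0 eB] Binj.
  exists (Num.min e (Num.min c (s0 - c))).
    by rewrite !lt_min e0 c0 subr_gt0.
  move=> d /andP[d0]; rewrite !lt_min => /andP[de /andP[dc ds]].
  have cc : {within `[c - d, c + d], continuous u} by apply: ucont'; lra.
  have ic : {in `[c - d, c + d] &, injective u}.
    move=> v w; rewrite !in_itv /= => /andP[v1 v2] /andP[w1 w2]; apply: Binj; apply: eB.
    - by rewrite /ball /= ltr_norml; apply/andP; split; lra.
    - by rewrite in_itv /=; apply/andP; split; lra.
    - by rewrite /ball /= ltr_norml; apply/andP; split; lra.
    - by rewrite in_itv /=; apply/andP; split; lra.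
  have lI : c - d \in `[c - d, c + d] by rewrite in_itv /=; apply/andP; split; lra.
  have rI : c + d \in `[c - d, c + d] by rewrite in_itv /=; apply/andP; split; lra.
  have cI : c \in `[c - d, c + d] by rewrite in_itv /=; apply/andP; split; lra.
  have lc : c - d < c by lra.
  have cr : c < c + d by lra.
  have [mon|mon] := itv_continuous_inj_mono cc ic.
    by rewrite (mon _ _ lI cI lc) (mon _ _ cI rI cr).
  by rewrite (mon _ _ cI lI lc) (mon _ _ rI cI cr) orbT.
have noext a b c : 0 < a -> a < c < b -> b <= s0 ->
    ~ (forall t, t \in `[a, b] -> u t <= u c) /\ ~ (forall t, t \in `[a, b] -> u c <= u t).
  move=> a0 /andP[ac cb] bs; have [|h h0 hP] := mono c; first by apply/andP; split; lra.
  pose d := Num.min (h / 2) (Num.min (c - a) (b - c)).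
  have d0 : 0 < d by rewrite !lt_min divr_gt0// !subr_gt0 ac cb.
  have dh : d <= h / 2 by rewrite ge_min lexx.
  have da : d <= c - a by rewrite !ge_min lexx orbT.
  have db : d <= b - c by rewrite !ge_min lexx !orbT.
  have lI : c - d \in `[a, b] by rewrite in_itv /=; apply/andP; split; lra.
  have rI : c + d \in `[a, b] by rewrite in_itv /=; apply/andP; split; lra.
  have dI : 0 < d < h by apply/andP; split; lra.
  by split => ext; have h1 := ext _ lI; have h2 := ext _ rI;
    case/orP: (hP d dI) => /andP[h3 h4]; lra.
have main a b : 0 < a -> a < b -> b <= s0 -> u a <> u b.
  move=> a0 ab bs uab; have cab := ucont' a b a0 bs.
  have [c1 c1I max1] := EVT_max (ltW ab) cab.
  have [c2 c2I min2] := EVT_min (ltW ab) cab.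
  have bnd c : c \in `[a, b] -> (a < c < b) \/ u c = u a.
    rewrite in_itv /= !le_eqVlt => /andP[/predU1P[<- _|ac /predU1P[->|cb]]].
    - by right.
    - by right.
    - by left; rewrite ac cb.
  have [c1ab|u1] := bnd _ c1I; first by have [] := noext a b c1 a0 c1ab bs.
  have [c2ab|u2] := bnd _ c2I; first by have [_] := noext a b c2 a0 c2ab bs.
  have mab : a < (a + b) / 2 < b by apply/andP; split; lra.
  have [+ _] := noext a b _ a0 mab bs; apply => t tI.
  apply: le_trans (max1 _ tI) _; rewrite u1 -u2; apply: min2.
  by case/andP: mab => m1 m2; rewrite in_itv /= !ltW.
move=> v w; rewrite !in_itv /= => /andP[v0 vs] /andP[w0 ws] uvw.
by have [vw|wv|//] := ltgtP v w; [have := main v w v0 vw ws|have := main w v w0 wv vs]; case.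
Qed.

End LocallyInjective.

(** * Freezing the parameters of a smooth family *)

Section Slices.
Context {R : realType}.

Lemma C1_at_opp (V W : normedModType R) (f : V -> W) x :
  C1_at f x -> C1_at (fun y => - f y) x.
Proof.
move=> [df cf]; split.
  by apply: filterS df => y dfy; exact: differentiableN.
move=> v; have E : \forall y \near x, - 'D_v f y = 'D_v (fun y => - f y) y.
  apply: filterS df => y dfy; apply/esym.
  by apply: deriveN; exact: diff_derivable.
rewrite /prop_for /continuous_at -(nbhs_singleton E : _ = _).
have : - 'D_v f y @[y --> x] --> - 'D_v f x by apply: cvgN; exact: cf.
by apply: cvg_trans; apply: near_eq_cvg.
Qed.

(** The set behind [smooth_on] is open in the whole product, so a parameter at the edge of its
    range, such as a zero [eps], can be frozen too. *)
Lemma smooth_on_slice (V1 V2 V3 W : normedModType R) (B1 : set V1) (B2 : set V2)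
    (B3 : set V3) (f : V1 -> V2 -> V3 -> W) a b p :
  smooth_on (B1 `*` B2 `*` B3) (fun z : V1 * V2 * V3 => f z.1.1 z.1.2 z.2) ->
  B1 a -> B2 b -> B3 p -> C1_at (f a b) p.
Proof.
set g := fun z : V1 * V2 * V3 => _ => gS B1a B2b B3p.
pose j (q : V3) : V1 * V2 * V3 := (a, b, q).
have dj q : is_diff q j (fun v => (0, 0, v)).
  exact: is_diff_pair.
have gj : \forall z \near j p, C1_at g z.
  by apply: (smooth_on_C1 gS); split => //; split.
have jc : {for p, continuous j} by exact: differentiable_continuous.
have gjn : \forall q \near p, C1_at g (j q) by exact: jc _ gj.
have Dj q v : 'D_v j q = (0, 0, v) by rewrite deriveE// diff_val.
split.
  apply: filterS gjn => q /C1_at_diff gq.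
  exact: (@differentiable_comp _ _ _ _ j g q).
move=> v.
have E : \forall q \near p, 'D_(0, 0, v) g (j q) = 'D_v (f a b) q.
  apply: filterS gjn => q /C1_at_diff gq.
  by have := @derive_comp _ _ _ _ j g q v _ gq; rewrite Dj => <-.
rewrite /prop_for /continuous_at -(nbhs_singleton E : _ = _).
have [_ cg] := nbhs_singleton gjn.
have : 'D_(0, 0, v) g (j q) @[q --> p] --> 'D_(0, 0, v) g (j p).
  exact: (@cvg_comp _ _ _ j ('D_(0, 0, v) g) _ _ _ jc (cg _)).
by apply: cvg_trans; apply: near_eq_cvg.
Qed.
End Slices.

(** * The divergence at critical points *)

Section Eigenvalue.
Context {R : realType}.
Local Notation plane := 'rV[R]_2.
Implicit Types (X Z : plane -> plane) (F : plane -> R) (p : plane).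

Lemma eigvalE X p : differentiable X p ->
  eigval X p = \sum_i ('D_(delta_mx 0 i) X p) 0 i.
Proof.
move=> dX; rewrite /eigval /mxtrace; apply: eq_bigr => i _.
by rewrite deriveEjacobian// -rowE [RHS]mxE.
Qed.

Lemma eigval_continuous X p : C1_at X p -> {for p, continuous (eigval X)}.
Proof.
move=> [dX cX].
have E : \forall q \near p, \sum_i ('D_(delta_mx 0 i) X q) 0 i = eigval X q.
  by apply: filterS dX => q dXq; rewrite eigvalE.
rewrite /prop_for /continuous_at -(nbhs_singleton E : _ = _).
have cs : \sum_i ('D_(delta_mx 0 i) X q) 0 i @[q --> p] --> \sum_i ('D_(delta_mx 0 i) X p) 0 i.
  have := @cvg_sum_ord _ _ _ _ _ (nbhs_filter p) (fun i q => ('D_(delta_mx 0 i) X q) 0 i)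
    (fun i => ('D_(delta_mx 0 i) X p) 0 i).
  apply=> i.
  exact: (@cvg_comp _ _ _ ('D_(delta_mx 0 i) X) (fun u : plane => u 0 i) _ _ _ (cX _) (@coord_continuous _ _ _ 0 i _)).
apply: cvg_trans cs.
exact: (@near_eq_cvg _ _ _ (nbhs_filter p)).
Qed.

(** At a zero of [F] the Jacobian of [F *: Z] is the rank-one product of [Z] with the differential
    of [F], whose trace is the derivative of [F] along [Z]. *)
Lemma eigval_local_expression X F Z p :
  (\forall q \near p, X q = F q *: Z q) -> F p = 0 ->
  differentiable X p -> differentiable F p -> differentiable Z p ->
  eigval X p = 'D_(Z p) F p.
Proof.
move=> XE F0 dX dF dZ; rewrite eigvalE// derive_row_sum//.
apply: eq_bigr => i _; rewrite -derive_coord//.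
have E : \forall q \near p, X q 0 i = (F * (fun q => Z q 0 i)) q.
  by apply: filterS XE => q ->; rewrite !mxE.
rewrite (near_eq_derive _ E) deriveM.
- by rewrite F0 scale0r add0r.
- exact: diff_derivable.
- by apply: diff_derivable; exact: differentiable_coord_comp.
Qed.
End Eigenvalue.

(** * Limit points of the orbits through the section *)

Section Basin.
Context {R : realType}.
Local Notation plane := 'rV[R]_2.

(** What the analysis at a critical point retains of a local expression. Under time reversal [G]
    absorbs the sign, while [Z] and the foliation are unchanged. *)
Definition local_factorization (A : set (@fol_chart R)) (X : plane -> plane) (p : plane)
    (G : plane -> R) (Z : plane -> plane) : Prop :=
  [/\ \forall q \near p, X q = G q *: Z q, \forall q \near p, C1_at G q,
      C1_at Z p, \forall q \near p, Z q != 0 & leaf_tangent A p (Z p)].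

Lemma local_factorization_opp A X p G Z : local_factorization A X p G Z ->
  local_factorization A (fun q => - X q) p (fun q => - G q) Z.
Proof.
move=> [XE G1 Z1 Z0 Zt]; split; [| |exact: Z1|exact: Z0|exact: Zt].
  by apply: filterS XE => q ->; rewrite scaleNr.
by apply: filterS G1 => q; exact: C1_at_opp.
Qed.

Lemma local_factorization_zero A X p G Z : local_factorization A X p G Z ->
  X p = 0 -> G p = 0.
Proof.
move=> [XE _ _ Z0 _]; rewrite (nbhs_singleton XE) => /eqP.
by rewrite scaler_eq0 (negbTE (nbhs_singleton Z0)) orbF => /eqP.
Qed.

Variables (M : set plane) (X : plane -> plane) (A : set (@fol_chart R)).
Hypothesis X_C1 : forall p, M p -> C1_at X p.
Hypothesis A_fol : is_foliation M A.
Hypothesis A_X : forall p, M p -> leaf_tangent A p (X p).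

(** Starts the continuation along orbits: since [sigma] is not tangent to the leaf, some chart has a
    transverse coordinate whose derivative along [sigma] is nonzero at [s], and which is therefore
    injective nearby. *)
Lemma section_separated (s0 s : R) (sigma : R -> plane) (x : R -> R -> plane) :
  smooth_on (`[0, s0] : set R) sigma -> 0 < s <= s0 -> M (sigma s) ->
  ~ leaf_tangent A (sigma s) ('D_1 sigma s) ->
  (forall r, 0 < r <= s0 -> x r 0 = sigma r) ->
  separated A (within (`]0, s0]%classic : set R) (nbhs s)) x (x s) 0.
Proof.
move=> sS sI Ms ntan x0; have s_sI : (`[0, s0]%classic : set R) s.
  by rewrite /= in_itv /=; case/andP: sI => /ltW-> ->.
have s1 := smooth_on_C1 sS s_sI; have ss := nbhs_singleton s1.
have [c [c_ cs Dc]] : exists c, [/\ A c, fdom c (sigma s) & 'D_('D_1 sigma s) (transverse_coord c) (sigma s) != 0].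
  move: ntan => /existsNP[c /not_implyP[c_ /not_implyP[cs /eqP Dc]]].
  by exists c.
have cC := foliation_chart A_fol c_.
have h1 := transverse_coord_C1 cC cs.
have hs := nbhs_singleton h1.
have DE : 'D_1 (transverse_coord c \o sigma) s = 'D_('D_1 sigma s) (transverse_coord c) (sigma s).
  by apply: derive_comp; exact: C1_at_diff.
have sc := C1_at_continuous ss.
have dh : \forall r \near s, differentiable (transverse_coord c \o sigma) r.
  have n1 : \forall r \near s, C1_at (transverse_coord c) (sigma r) by exact: sc _ h1.
  by apply: filterS2 s1 n1 => r sr hr; apply: differentiable_comp; exact: C1_at_diff.
have ch := @derive_comp_continuous _ _ _ _ sigma (transverse_coord c) s (1 : R^o) ss hs.
have Dh : 'D_1 (transverse_coord c \o sigma) s != 0 by rewrite DE.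
have [B sB Binj] := locally_injective dh ch Dh.
apply: (separated_chart A_fol c_); first by rewrite x0.
  rewrite x0//; have : sigma r @[r --> within (`]0, s0]%classic : set R) (nbhs s)] --> sigma s.
    by apply: cvg_trans sc; apply: cvg_app; exact: cvg_within.
  apply: cvg_trans; apply: near_eq_cvg; near=> r.
  have : (`]0, s0]%classic : set R) r by near: r; exact: withinT.
  by rewrite /= in_itv /= => /x0.
exists (B `&` `]0, s0]%classic).
  by apply: filterI; [exact: cvg_within sB|exact: withinT].
move=> i j [Bi iI] [Bj jI]; rewrite !x0; last 2 first.
- by move: jI; rewrite /= in_itv.
- by move: iI; rewrite /= in_itv.
by move=> hij; apply: Binj; rewrite ?inE.
Unshelve. all: by end_near. Qed.

(** Stated for any field with an attracting curve, so that it also applies to the reversed field.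
    Trajectories are chosen for all [s] at once because the local argument compares neighbouring
    ones. *)
Lemma basin_param_injective (s0 : R) (sigma om gam : R -> plane) (u : R -> R) (a b : R) :
  smooth_on (`[0, s0] : set R) sigma ->
  (forall s, 0 <= s <= s0 -> M (sigma s)) ->
  (forall s, 0 <= s <= s0 -> ~ leaf_tangent A (sigma s) ('D_1 sigma s)) ->
  (forall s, 0 < s <= s0 -> exists x, [/\ trajectory M X x, x 0 = sigma s &
    x t @[t --> +oo] --> om s]) ->
  {in `]a, b[, continuous gam} -> {in `]a, b[ &, injective gam} ->
  (forall v, v \in `]a, b[ -> M (gam v) /\ X (gam v) = 0) ->
  (forall v, v \in `]a, b[ -> exists G Z, local_factorization A X (gam v) G Z /\
    'D_(Z (gam v)) G (gam v) < 0) ->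
  (forall s, 0 < s <= s0 -> (u s \in `]a, b[) /\ gam (u s) = om s) ->
  {in `]0, s0] &, injective u}.
Proof.
move=> sS sM st sx gc gi gX gG gu.
have [x xP] : {x : R -> R -> plane & forall s, 0 < s <= s0 ->
    [/\ trajectory M X (x s), x s 0 = sigma s & x s t @[t --> +oo] --> om s]}.
  exists (fun s => xget (fun=> 0) [set x | [/\ trajectory M X x, x 0 = sigma s &
    x t @[t --> +oo] --> om s]]) => s sI.
  apply: (@xgetPex _ (fun=> 0) [set x | [/\ trajectory M X x, x 0 = sigma s &
    x t @[t --> +oo] --> om s]]).
  exact: sx.
pose D : set R := `]0, s0]%classic.
have xM i : D i -> trajectory M X (x i) by rewrite /D/= in_itv /= => /xP[].
have xom i : D i -> x i t @[t --> +oo] --> om i by rewrite /D/= in_itv /= => /xP[].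
have guD i : D i -> (u i \in `]a, b[) /\ gam (u i) = om i.
  by rewrite /D/= in_itv /= => /gu.
suff loc s : 0 < s <= s0 -> (u r @[r --> within D (nbhs s)] --> u s) /\
    exists2 B, within D (nbhs s) B & forall r r', B r -> B r' -> u r = u r' -> r = r'.
  by apply: locally_injective_injective => s /loc[].
move=> sI; have [sM' sx0 s_om] := xP s sI; have [uI gus] := gu s sI.
have sI' : 0 <= s <= s0 by case/andP: sI => /ltW-> ->.
have [Mg Xg] := gX _ uI; have [G [Z [GZ DZG]]] := gG _ uI.
have G0 := local_factorization_zero GZ Xg.
have [XE G1 Z1 Z0 Zt] := GZ.
have FD : within D (nbhs s) D by exact: withinT.
have sep := section_separated sS sI (sM s sI') (st s sI')
  (fun r rI => let: And3 _ h _ := xP r rI in h).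
have Zc := C1_at_continuous Z1.
have gXz v : v \in `]a, b[ -> X (gam v) = 0 by move=> /gX[].
rewrite -gus in s_om.
split.
  exact: (end_param_cvg X_C1 A_fol A_X FD xM sM' sep xom s_om Mg XE G1 Zc G0 DZG gc gi gXz Z0 Zt guD uI erefl).
exact: (end_param_inj X_C1 A_fol A_X FD xM sM' sep xom s_om Mg XE G1 Zc G0 DZG guD).
Qed.
End Basin.

(** * Fixed points of the slow relation function *)

Section FixedPoints.
Context {R : realType} (s0 : R) (S : R -> R).
Hypothesis s0_gt0 : 0 < s0.
Hypothesis S_itv : forall s : R, 0 <= s <= s0 -> 0 <= S s <= s0.
Hypothesis S_cont : {within `[0, s0], continuous S}.
Hypothesis S0 : S 0 = 0.

(** [f] and [g] stand for [Im] and [Ip] in either order, which covers both cases in the definition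
    of [S]. Since [f s != 0], the value [S s] is positive for [s > 0]; this extends injectivity to
    the end point [0] and rules out a decreasing [S]. *)
Lemma slow_relation_monotone (f g : R -> R) :
  (forall s, 0 < s <= s0 -> f s + g (S s) = 0) -> g 0 = 0 ->
  {in `]0, s0] &, injective f} -> {in `]0, s0] &, injective g} ->
  (forall s, 0 < s <= s0 -> f s != 0) ->
  {in `[0, s0] &, {homo S : x y / x <= y}} /\
  (forall s, 0 < s <= s0 -> f s + g s = 0 <-> S s = s).
Proof.
move=> fg g0 fi gi f0.
have Sp s : 0 < s <= s0 -> 0 < S s <= s0.
  move=> sI; have sI' : 0 <= s <= s0 by case/andP: sI => /ltW-> ->.
  have /andP[S1 S2] := S_itv sI'; rewrite S2 andbT lt_neqAle S1 andbT eq_sym.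
  apply: contraNneq (f0 s sI) => Ss; have := fg s sI.
  by rewrite Ss g0 addr0 => ->.
have inI s : (s \in `]0, s0]) = (0 < s <= s0) by rewrite in_itv.
have Sinj : {in `[0, s0] &, injective S}.
  move=> s t; rewrite !in_itv /= => /andP[sp s1] /andP[tp t1] St.
  have [sz|sn] := eqVneq s 0; have [tz|tn] := eqVneq t 0.
  - by rewrite sz tz.
  - have tI : 0 < t <= s0 by rewrite lt_neqAle eq_sym tn tp.
    by have := Sp t tI; rewrite -St sz S0 ltxx.
  - have sI : 0 < s <= s0 by rewrite lt_neqAle eq_sym sn sp.
    by have := Sp s sI; rewrite St tz S0 ltxx.
  have tI : 0 < t <= s0 by rewrite lt_neqAle eq_sym tn tp.
  have sI : 0 < s <= s0 by rewrite lt_neqAle eq_sym sn sp.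
  apply: fi; rewrite ?inI//.
  by have := fg s sI; have := fg t tI; rewrite St; lra.
have zI : 0 \in `[0, s0] by rewrite in_itv /= lexx ltW.
split.
  have [mon|mon] := itv_continuous_inj_mono S_cont Sinj.
    move=> x y xI yI; rewrite le_eqVlt => /predU1P[->//|xy].
    exact/ltW/mon.
  have s0I : s0 \in `[0, s0] by rewrite in_itv /= lexx ltW.
  have := mon _ _ s0I zI s0_gt0; rewrite S0.
  have /Sp/andP[h _] : 0 < s0 <= s0 by rewrite s0_gt0 lexx.
  by move=> h'; have := lt_trans h h'; rewrite ltxx.
move=> s sI; split => [fgs|Ss]; last by have := fg s sI; rewrite Ss.
apply: gi; rewrite ?inI ?Sp//.
by have := fg s sI; move: fgs; lra.
Qed.

Hypothesis S_homo : {in `[0, s0] &, {homo S : x y / x <= y}}.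
Variable zero : R -> Prop.
Hypothesis zeroP : forall s, 0 < s <= s0 -> zero s <-> S s = s.

Lemma dirac_invariant_zero s : 0 < s <= s0 -> zero s <-> invariant_measure s0 S \d_s.
Proof.
move=> sI; have sI' : 0 <= s <= s0 by case/andP: sI => /ltW-> ->.
by split => [/(zeroP sI)|] => [Ss|h]; [exact/dirac_invariant_measureP|
  apply/(zeroP sI)/(dirac_invariant_measureP S sI')].
Qed.

Lemma uniquely_ergodic_zero :
  (forall s, 0 < s <= s0 -> ~ zero s) <-> uniquely_ergodic s0 S.
Proof.
have zI : 0 <= (0 : R) <= s0 by rewrite lexx ltW.
split => [nz|[_ uniq] s sI zs].
  split; first exact/dirac_invariant_measureP.
  (* Over an empty family of zeros the hull reduces to the Dirac measure at [0]. *)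
  move=> mu muS B mB; pose z (i : 'I_0) : R := 0.
  have [|||e0 [e [_ _ e1 ->//]]] := @invariant_measure_in_hull _ s0 S S_itv S_cont S_homo 0 z mu _ _ _ muS.
  - by case.
  - by case.
  - by move=> s sI Ss; case: (nz s sI); exact/zeroP.
  rewrite big_ord0 addr0 in e1.
  by rewrite big_ord0 adde0 e1 mul1e.
(* A zero at [s] makes [\d_s] a second invariant measure, told apart from the Dirac measure at [0]
   by [[set s]]. *)
have /uniq /(_ [set s] (measurable_set1 _)) : invariant_measure s0 S \d_s by exact/dirac_invariant_zero.
have dE (x : R) : (\d_x : probability R R) [set s] = ((x \in [set s])%:R)%:E by exact: diracE.
rewrite !dE mem_set// => /eqP; rewrite eqe memNset ?oner_eq0// => s_0.
by move: sI; rewrite -s_0 ltxx.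
Qed.

Lemma invariant_hull_zero (k : nat) (z : 'I_k -> R) :
  (forall i, 0 < z i <= s0) -> (forall i j : 'I_k, (i < j)%N -> z i < z j) ->
  (forall s, 0 < s <= s0 -> zero s <-> exists i, s = z i) <->
  (forall mu : probability R R, invariant_measure s0 S mu <-> in_hull_of_diracs z mu).
Proof.
move=> zI zlt.
have zinj : injective z.
  move=> i j zij; case: (ltngtP i j) => [/zlt|/zlt|/val_inj//]; by rewrite zij ltxx.
have zI' i : 0 <= z i <= s0 by case/andP: (zI i) => /ltW-> ->.
split => [zP mu|hull s sI].
  split => [muS|].
    apply: (@invariant_measure_in_hull _ s0 S S_itv S_cont S_homo k z mu _ zinj _ muS).
      by move=> i; case/andP: (zI i).
    by move=> s sI /(zeroP sI)/(zP s sI).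
  apply: in_hull_invariant_measure => //; first exact: ltW.
  by move=> i; apply/(zeroP (zI i))/zP => //; exists i.
have dE (x y : R) : (\d_x : probability R R) [set y] = ((x \in [set y])%:R)%:E by exact: diracE.
split.
  (* As [s] is not [0], a combination of the Dirac measures gives [[set s]] mass zero unless [s] is
     some [z i], whereas [\d_s] gives it mass one. *)
  move=> /(dirac_invariant_zero sI)/hull[e0 [e [_ _ e1 muE]]].
  apply: contrapT => nz; have := muE [set s] (measurable_set1 _).
  have d0 x : x <> s -> \d_x [set s] = 0%E :> \bar R.
    by move=> xs; rewrite diracE memNset.
  rewrite dE mem_set// d0 ?mule0 ?add0e; last by move=> s_0; move: sI; rewrite -s_0 ltxx.
  rewrite big1 => [/eqP|i _]; first by rewrite eqe oner_eq0.
  by rewrite d0 ?mule0// => zs; apply: nz; exists i.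
move=> [i ->]; apply/(dirac_invariant_zero (zI i))/hull.
exists 0, (fun j => (j == i)%:R); split => //.
- by rewrite add0r (bigD1 i)//= eqxx big1 ?addr0// => j /negbTE ->.
move=> B mB; rewrite mul0e add0e (bigD1 i)//= eqxx mul1e big1 ?adde0//.
by move=> j /negbTE ->; rewrite mul0e.
Qed.

End FixedPoints.

(** * Slow-fast systems *)

Section SlowFast.
Context {R : realType} {r : nat}.
Local Notation plane := 'rV[R]_2.
Variables (M : set plane) (Lam : set 'rV[R]_r) (lam0 : 'rV[R]_r) (eps0 : R)
  (X : 'rV[R]_r -> R -> plane -> plane) (Q : 'rV[R]_r -> plane -> plane)
  (fol : set (@fol_chart R)) (p0 : plane) (gam : R -> plane).
Hypothesis hX : slow_fast_family M Lam lam0 eps0 X Q.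
Hypothesis hfol : fast_foliation M (X lam0 0) fol.
Hypothesis hA1 : assumption1 M (X lam0 0) p0 gam.

Lemma fast_C1 p : M p -> C1_at (X lam0 0) p.
Proof.
case: hX => [[_ _ L0 e0] Xs _ _] Mp.
apply: (smooth_on_slice Xs L0 _ Mp).
by rewrite /= in_itv /= lexx.
Qed.

Lemma fast_leaf_tangent p : M p -> leaf_tangent fol p (X lam0 0 p).
Proof.
case: hfol => _ _ h Mp; have [[_ X0 _]|nc] := pselect (critical_set M (X lam0 0) p).
  by rewrite X0 => c _ _; rewrite derive0.
exact: h.
Qed.

Lemma fast_foliation_is : is_foliation M fol.
Proof. by case: hfol. Qed.

Lemma gam_C1 u : -1 < u < 1 -> C1_at gam u.
Proof.
case: hA1 => [[gs _ _ _ _] _ _ _] uI; apply: (smooth_on_C1_at gs).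
by rewrite /= in_itv.
Qed.

Lemma gam_critical u : -1 < u < 1 -> critical_set M (X lam0 0) (gam u).
Proof.
case: hA1 => [[_ _ _ <- _] _ _ _] uI.
by exists u => //; rewrite /= in_itv.
Qed.

Lemma critical_factorization p : critical_set M (X lam0 0) p ->
  exists G Z, local_factorization fol (X lam0 0) p G Z /\
    'D_(Z p) G p = eigval (X lam0 0) p.
Proof.
move=> cp; case: hX => _ _ _ /(_ p cp)[U [L [F [Z [[Up _ L0 _] _ _ /(_ _ L0) le]]]]].
have [[oU UM FS ZS] XE Z0 _] := le.
have nU : nbhs p U by exact: open_nbhs_nbhs.
exists (F lam0), (Z lam0).
have lf : local_factorization fol (X lam0 0) p (F lam0) (Z lam0).
  split.
  - by apply: filterS nU => q; exact: XE.
  - exact: (smooth_on_C1 FS Up).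
  - exact: (smooth_on_C1_at ZS Up).
  - by apply: filterS nU => q; exact: Z0.
  - by case: hfol => _ h _; exact: (h U _ _ _ le Up).
split => //; apply/esym; apply: eigval_local_expression.
- by case: lf.
- by apply: (local_factorization_zero lf); case: cp.
- by apply: C1_at_diff; apply: fast_C1; case: cp.
- exact: C1_at_diff (smooth_on_C1_at FS Up).
- exact: C1_at_diff (smooth_on_C1_at ZS Up).
Qed.

Lemma gam_cont u : u \in `]-1, 1[ -> {for u, continuous gam}.
Proof. by rewrite in_itv /= => /gam_C1/C1_at_continuous. Qed.

Lemma gam_inj : {in `]-1, 1[ &, injective gam}.
Proof. by case: hA1 => [[_ _ gi _ _] _ _ _]. Qed.

Variables (s0 : R) (sigma om al : R -> plane).
Hypothesis hsigma : transverse_section M fol p0 s0 sigma.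
Hypothesis hlim : section_limits M (X lam0 0) gam s0 sigma om al.

Lemma omega_param_injective (u : R -> R) :
  (forall s, 0 < s <= s0 -> -1 < u s < 0 /\ gam (u s) = om s) ->
  {in `]0, s0] &, injective u}.
Proof.
move=> uP; case: hsigma => [[sS _] _ sM _ st].
have sub (v : R) : v \in `]-1, 0[ -> v \in `]-1, 1[.
  by rewrite !in_itv /= => /andP[-> /lt_trans]; apply.
have sub' (v : R) : v \in `]-1, 0[ -> -1 < v < 1 by move=> /sub; rewrite in_itv.
apply: (@basin_param_injective _ M (X lam0 0) fol fast_C1 fast_foliation_is
  fast_leaf_tangent s0 sigma om gam u (-1) 0 sS sM st).
- move=> s sI; have [_ _ [x [x0 xM _ xom]]] := hlim sI.
  by exists x; split.
- by move=> v /sub; exact: gam_cont.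
- by move=> v w /sub vI /sub wI; exact: gam_inj.
- by move=> v /sub' /gam_critical[].
- move=> v vI; have [G [Z [lf E]]] := critical_factorization (gam_critical (sub' v vI)).
  exists G, Z; split => //; rewrite E.
  case: hA1 => _ att _ _; have [] : attracting (X lam0 0) (gam v) by apply: att; exists v.
  by [].
- by move=> s /uP[]; rewrite in_itv.
Qed.

(** For the reversed field the leaves are the same, alpha-limits become omega-limits, and the sign
    change of [G] makes the repelling branch attracting. *)
Lemma alpha_param_injective (u : R -> R) :
  (forall s, 0 < s <= s0 -> 0 < u s < 1 /\ gam (u s) = al s) ->
  {in `]0, s0] &, injective u}.
Proof.
move=> uP; case: hsigma => [[sS _] _ sM _ st].
have sub (v : R) : v \in `]0, 1[ -> v \in `]-1, 1[.
  by rewrite !in_itv /= => /andP[v0 ->]; rewrite andbT (lt_trans _ v0)// ltrN10.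
have sub' (v : R) : v \in `]0, 1[ -> -1 < v < 1 by move=> /sub; rewrite in_itv.
have opp_C1 p : M p -> C1_at (fun q => - X lam0 0 q) p by move=> /fast_C1/C1_at_opp.
have opp_tangent p : M p -> leaf_tangent fol p (- X lam0 0 p).
  move=> Mp c c_ cp; have cC := foliation_chart fast_foliation_is c_.
  rewrite deriveNv; last exact: C1_at_diff (nbhs_singleton (transverse_coord_C1 cC cp)).
  by rewrite (fast_leaf_tangent Mp c_ cp) oppr0.
apply: (@basin_param_injective _ M (fun q => - X lam0 0 q) fol opp_C1 fast_foliation_is
  opp_tangent s0 sigma al gam u 0 1 sS sM st).
- move=> s sI; have [_ _ [x [x0 xM xal _]]] := hlim sI.
  exists (fun t => x (- t)); split; first exact: trajectory_opp.
    by rewrite oppr0.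
  by have := (cvgNy_compNP x (nbhs (al s))).1 xal.
- by move=> v /sub; exact: gam_cont.
- by move=> v w /sub vI /sub wI; exact: gam_inj.
- by move=> v /sub' /gam_critical[? -> _]; rewrite oppr0.
- move=> v vI; have [G [Z [lf E]]] := critical_factorization (gam_critical (sub' v vI)).
  exists (fun q => - G q), Z; split; first exact: local_factorization_opp.
  have [_ G1 _ _ _] := lf.
  have -> : 'D_(Z (gam v)) (fun q => - G q) (gam v) = - 'D_(Z (gam v)) G (gam v).
    by apply: deriveN; exact: diff_derivable (C1_at_diff (nbhs_singleton G1)).
  rewrite E oppr_lt0.
  case: hA1 => _ _ rep _; have [] : repelling (X lam0 0) (gam v) by apply: rep; exists v.
  by [].
- by move=> s /uP[]; rewrite in_itv.
Qed.

Let Qh := slow_field (critical_set M (X lam0 0)) fol (Q lam0).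
Hypothesis hA3 : assumption3 Qh gam.
Variables (Im Ip : R -> R).
Hypothesis hI : section_integrals (X lam0 0) Qh gam s0 om al Im Ip.

Let speed (u : R) : R := xget 1 [set a : R | 0 < a /\ Qh (gam u) = a *: 'D_1 gam u].

Let speedP u : -1 < u < 1 -> u != 0 -> 0 < speed u /\ Qh (gam u) = speed u *: 'D_1 gam u.
Proof.
move=> uI u0; apply: (@xgetPex _ 1 [set a : R | 0 < a /\ Qh (gam u) = a *: 'D_1 gam u]).
by have [a a0 E] := hA3 uI u0; exists a.
Qed.

(** The density of the slow divergence integral in the parameter of [gam]: one unit of parameter
    takes the slow time [1 / speed]. *)
Let k (u : R) : R := eigval (X lam0 0) (gam u) / speed u.

Let k_lt0 u : -1 < u < 0 -> k u < 0.
Proof.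
move=> /andP[u1 u0]; have uI : -1 < u < 1 by rewrite u1 (lt_trans u0).
have [a0 _] := speedP uI (ltr0_neq0 u0).
rewrite /k pmulr_llt0 ?invr_gt0//.
case: hA1 => _ att _ _; have [] : attracting (X lam0 0) (gam u).
  by apply: att; exists u => //; rewrite /= in_itv /= u1.
by [].
Qed.

Let k_gt0 u : 0 < u < 1 -> 0 < k u.
Proof.
move=> /andP[u0 u1]; have uI : -1 < u < 1 by rewrite u1 (lt_trans _ u0)// ltrN10.
have [a0 _] := speedP uI (lt0r_neq0 u0).
rewrite /k divr_gt0//.
case: hA1 => _ _ rep _; have [] : repelling (X lam0 0) (gam u).
  by apply: rep; exists u => //; rewrite /= in_itv /= u0.
by [].
Qed.

(** The segment has to stay on one side of the contact point, at which the slow field is not known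
    to be a positive multiple of the velocity of [gam]. *)
Let integral_increment (u1 u2 l : R) : -1 < u1 -> u1 < u2 -> u2 < 1 -> u2 < 0 \/ 0 < u1 ->
  slow_divergence_integral (X lam0 0) Qh gam u1 u2 l -> increment k u1 u2 l.
Proof.
move=> h1 u12 h2 h0.
have sub (u : R) : u \in `[u1, u2] -> -1 < u < 1.
  by rewrite in_itv /= => /andP[a b]; apply/andP; split; lra.
have sub0 (u : R) : u \in `[u1, u2] -> u != 0.
  rewrite in_itv /= => /andP[a b]; apply/eqP => u0; move: a b; rewrite u0.
  by case: h0; lra.
have c1 u : u \in `[u1, u2] -> derivable gam u 1 /\ 'D_1 gam u != 0.
  move=> /sub uI; split.
    by apply: diff_derivable; exact: C1_at_diff (gam_C1 uI).
  by case: hA1 => [[_ h _ _ _] _ _ _]; exact: h.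
have c2 : {in `[u1, u2] &, injective gam}.
  by move=> u v /sub uI /sub vI; apply: gam_inj; rewrite in_itv.
have c3 u : u \in `[u1, u2] -> 0 < speed u /\ Qh (gam u) = speed u *: 'D_1 gam u.
  by move=> uI; apply: speedP; [exact: sub|exact: sub0].
have c4 u : u \in `[u1, u2] -> {for gam u, continuous (eigval (X lam0 0))}.
  by move=> /sub /gam_critical[Mg _ _]; exact: eigval_continuous (fast_C1 Mg).
exact: (slow_divergence_increment u12 c1 c2 c3 c4).
Qed.

(** The parameter hidden in [I_minus] is only known to exist; injectivity of [gam] identifies it
    with [u]. *)
Lemma I_minus_increment (u l : R) : -1 < u < 0 -> I_minus (X lam0 0) Qh gam (gam u) l ->
  increment_to0 k u l.
Proof.
move=> /andP[u1 u0] [v [/andP[v1 v0] uv [J JP Jl]]].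
have E : u = v.
  apply: gam_inj uv; rewrite in_itv /= ?u1 ?v1 /=; first exact: lt_trans u0 _.
  exact: lt_trans v0 _.
exists J; last exact: Jl.
move=> t /andP[ut t0]; apply: (integral_increment u1 ut (lt_trans t0 ltr01)); first by left.
by rewrite E; apply: JP; rewrite -E ut.
Qed.

Lemma I_plus_increment (u l : R) : 0 < u < 1 -> I_plus (X lam0 0) Qh gam (gam u) l ->
  increment_to0 (fun v => - k (- v)) (- u) (- l).
Proof.
move=> /andP[u0 u1] [v [/andP[v0 v1] uv [J JP Jl]]].
have E : u = v.
  apply: gam_inj uv; rewrite in_itv /= ?u1 ?v1 andbT; first exact: lt_trans u0.
  exact: lt_trans v0.
exists (fun t => - J (- t)).
  move=> t /andP[ut t0].
  have t0' : 0 < - t by lra.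
  have t1 : -1 < - t by lra.
  have tu : - t < u by lra.
  rewrite -[t in increment _ _ t]opprK; apply: increment_opp.
  apply: (integral_increment t1 tu u1); first by right.
  by rewrite E; apply: JP; rewrite -E; apply/andP; split; lra.
apply: cvgN; have := (cvg_at_rightNP J 0 l).1 Jl.
by rewrite oppr0.
Qed.

Lemma Im_neq0 s : 0 < s <= s0 -> Im s != 0.
Proof.
move=> sI; case: hI => _ _ /(_ s sI)[Ims _].
have [[u uI uom] _ _] := hlim sI; rewrite -uom in Ims.
have uI' : -1 < u < 0 by move: uI; rewrite /= in_itv.
by rewrite lt_eqF// (increment_to0_lt0 k_lt0 uI' (I_minus_increment uI' Ims)).
Qed.

Let k_opp_lt0 u : -1 < u < 0 -> - k (- u) < 0.
Proof. by move=> /andP[u1 u0]; rewrite oppr_lt0; apply: k_gt0; apply/andP; split; lra. Qed.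

Lemma Ip_neq0 s : 0 < s <= s0 -> Ip s != 0.
Proof.
move=> sI; case: hI => _ _ /(_ s sI)[_ Ips].
have [_ [u uI ual] _] := hlim sI; rewrite -ual in Ips.
have uI' : 0 < u < 1 by move: uI; rewrite /= in_itv.
have uI2 : -1 < - u < 0 by apply/andP; case/andP: uI' => *; split; lra.
have := increment_to0_lt0 k_opp_lt0 uI2 (I_plus_increment uI' Ips).
by rewrite oppr_lt0 => /lt0r_neq0.
Qed.

Lemma Im_inj : {in `]0, s0] &, injective Im}.
Proof.
pose u s := xget 0 [set u : R | -1 < u < 0 /\ gam u = om s].
have uP s : 0 < s <= s0 -> -1 < u s < 0 /\ gam (u s) = om s.
  move=> sI; apply: (@xgetPex _ 0 [set u : R | -1 < u < 0 /\ gam u = om s]).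
  by have [[v vI vom] _ _] := hlim sI; exists v; split => //; move: vI; rewrite /= in_itv.
have H s : 0 < s <= s0 -> increment_to0 k (u s) (Im s).
  move=> sI; have [uI gu] := uP s sI; apply: I_minus_increment => //.
  by rewrite gu; case: hI => _ _ /(_ s sI)[].
move=> s t sI tI st; apply: (omega_param_injective uP) => //.
rewrite !in_itv /= in sI tI.
have [us _] := uP s sI; have [ut _] := uP t tI.
by apply: (increment_to0_inj k_lt0 us ut (H s sI)); rewrite st; exact: H.
Qed.

Lemma Ip_inj : {in `]0, s0] &, injective Ip}.
Proof.
pose u s := xget 0 [set u : R | 0 < u < 1 /\ gam u = al s].
have uP s : 0 < s <= s0 -> 0 < u s < 1 /\ gam (u s) = al s.
  move=> sI; apply: (@xgetPex _ 0 [set u : R | 0 < u < 1 /\ gam u = al s]).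
  by have [_ [v vI val_] _] := hlim sI; exists v; split => //; move: vI; rewrite /= in_itv.
have H s : 0 < s <= s0 -> increment_to0 (fun v => - k (- v)) (- u s) (- Ip s).
  move=> sI; have [uI gu] := uP s sI; apply: I_plus_increment => //.
  by rewrite gu; case: hI => _ _ /(_ s sI)[].
move=> s t sI tI st; apply: (alpha_param_injective uP) => //.
rewrite !in_itv /= in sI tI.
have [/andP[us0 us1] _] := uP s sI; have [/andP[ut0 ut1] _] := uP t tI.
have us : -1 < - u s < 0 by apply/andP; split; lra.
have ut : -1 < - u t < 0 by apply/andP; split; lra.
apply: oppr_inj; apply: (increment_to0_inj k_opp_lt0 us ut (H s sI)).
by rewrite st; exact: H.
Qed.

Variable S : R -> R.
Hypothesis hS : slow_relation_function s0 Im Ip S.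
Hypothesis hs0 : 0 < s0.

Lemma slow_relation_fixed :
  {in `[0, s0] &, {homo S : x y / x <= y}} /\
  (forall s, 0 < s <= s0 -> Im s + Ip s = 0 <-> S s = s).
Proof.
case: hS => S_itv S_cont S0 case1 case2; case: hI => Im0 Ip0 _.
have [le|lt] := leP (- Im s0) (Ip s0).
  exact: (slow_relation_monotone hs0 S_itv S_cont S0 (case1 le) Ip0 Im_inj Ip_inj Im_neq0).
have case2' s : 0 < s <= s0 -> Ip s + Im (S s) = 0 by move=> /(case2 lt); rewrite addrC.
have [mon fixP] := slow_relation_monotone hs0 S_itv S_cont S0 case2' Im0 Ip_inj Im_inj Ip_neq0.
by split => // s sI; rewrite addrC; exact: fixP.
Qed.
End SlowFast.

Theorem theorem1 (R : realType) (r : nat)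
    (M : set 'rV[R]_2) (Lam : set 'rV[R]_r) (lam0 : 'rV[R]_r) (eps0 : R)
    (X : 'rV[R]_r -> R -> 'rV[R]_2 -> 'rV[R]_2)
    (Q : 'rV[R]_r -> 'rV[R]_2 -> 'rV[R]_2)
    (fol : set (@fol_chart R))
    (p0 : 'rV[R]_2) (gam : R -> 'rV[R]_2)
    (n : option nat) (m : nat)
    (s0 : R) (sigma om al : R -> 'rV[R]_2)
    (Im Ip S : R -> R)
    (hX : slow_fast_family M Lam lam0 eps0 X Q)
    (hfol : fast_foliation M (X lam0 0) fol)
    (hA1 : assumption1 M (X lam0 0) p0 gam)
    (hn : contact_order M (X lam0 0) fol p0 n)
    (hm : singularity_order M (X lam0 0) (Q lam0) p0 (Some m))
    (hA2 : odd m)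
    (hA3 : assumption3
             (slow_field (critical_set M (X lam0 0)) fol (Q lam0)) gam)
    (hA4 : assumption4 n m)
    (hs0 : 0 < s0)
    (hsigma : transverse_section M fol p0 s0 sigma)
    (hlim : section_limits M (X lam0 0) gam s0 sigma om al)
    (hI : section_integrals (X lam0 0)
            (slow_field (critical_set M (X lam0 0)) fol (Q lam0))
            gam s0 om al Im Ip)
    (hS : slow_relation_function s0 Im Ip S) :
  [/\ (forall s : R, 0 < s <= s0 -> Im s + Ip s <> 0) <-> uniquely_ergodic s0 S,
      forall s1 : R, 0 < s1 <= s0 ->
        (Im s1 + Ip s1 = 0 <-> invariant_measure s0 S \d_s1) &
      forall (k : nat) (z : 'I_k -> R),
        (forall i, 0 < z i <= s0) ->
        (forall i j : 'I_k, (i < j)%N -> z i < z j) ->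
        ((forall s : R, 0 < s <= s0 -> (Im s + Ip s = 0 <-> exists i, s = z i)) <->
         (forall mu : probability R R,
            invariant_measure s0 S mu <-> in_hull_of_diracs z mu))].
Proof.
have [S_itv S_cont S0 _ _] := hS.
have [S_homo fixP] := slow_relation_fixed hX hfol hA1 hsigma hlim hA3 hI hS hs0.
split.
- exact: (uniquely_ergodic_zero hs0 S_itv S_cont S0 S_homo fixP).
- by move=> s1 s1I; exact: (dirac_invariant_zero fixP s1I).
- move=> k z zI zlt.
  exact: (invariant_hull_zero hs0 S_itv S_cont S0 S_homo fixP zI zlt).
Qed.
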